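(* Let $n \ge 1$ be an integer. Let $f : A \to B$ be a pure ring homomorphism between commutative rings. Assume that $B$ is a Noetherian ring which satisfies Serre's $(S_n)$ condition. If the fiber ring $B \otimes_A \kappa(\mathfrak{p})$ is zero-dimensional for every prime ideal $\mathfrak{p}$ of $A$, then $A$ satisfies Serre's $(S_n)$ condition, too.
   Context: All rings are commutative with identity. A ring homomorphism $f : A \to B$ is called pure if for every $A$-module $W$ the map $j_W : W \to B \otimes_A W$, $j_W(w) = 1 \otimes w$, is injective. For a prime ideal $\mathfrak{p}$ of $A$, $\kappa(\mathfrak{p}) = A_{\mathfrak{p}}/\mathfrak{p}A_{\mathfrak{p}}$ denotes the residue field of $A_{\mathfrak{p}}$. ''Zero-dimensional'' refers to Krull dimension. A Noetherian commutative ring $R$ satisfies Serre's condition $(S_n)$ if $\operatorname{depth} R_{\mathfrak{p}} \ge \min(n, \dim R_{\mathfrak{p}})$ for every $\mathfrak{p} \in \operatorname{Spec} R$; saying that a ring satisfies $(S_n)$ includes that it is Noetherian. (It is known that if $A \to B$ is pure and $B$ is Noetherian, then $A$ is Noetherian.) *)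

(* Defs.v *)
From HB Require Import structures.
From mathcomp Require Import all_boot all_order all_algebra.
From mathcomp Require Import boolp classical_sets constructive_ereal.
From mathcomp Require Import ring.

Set Implicit Arguments.
Unset Strict Implicit.
Unset Printing Implicit Defensive.

Import Order.TTheory GRing.Theory Num.Theory.

Local Open Scope classical_set_scope.
Local Open Scope quotient_scope.
Local Open Scope ring_scope.

(* Rings are comPzRingType, so that the zero ring is allowed. The library's
   ideals (ring_quotient) exist only over nontrivial rings and are proper, so
   ideals and prime ideals of an arbitrary commutative ring are plain sets. *)

Section Ideals.
Variable R : comPzRingType.

Definition is_ideal (I : set R) : Prop :=
  [/\ I 0, forall x y, I x -> I y -> I (x + y) & forall a x, I x -> I (a * x)].

Definition is_prime (P : set R) : Prop :=
  [/\ is_ideal P, ~ P 1 & forall x y, P (x * y) -> P x \/ P y].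

Definition ideal_gen (xs : seq R) : set R :=
  [set \sum_(i < size xs) c i * xs`_i | c in [set: 'I_(size xs) -> R]].

Definition noetherian : Prop :=
  forall I : set R, is_ideal I -> exists xs : seq R, I = ideal_gen xs.

Record spec := Spec { spec_set :> R -> Prop; specP : is_prime spec_set }.

End Ideals.

(* Supremum of a set of natural numbers in Z extended by -oo and +oo; it is
   -oo on the empty set. *)
Definition sup_nat (P : set nat) : \bar int :=
  supremum -oo%E [set (n%:Z)%:E | n in P].

Lemma sup_nat0 : sup_nat set0 = -oo%E.
Proof. by rewrite /sup_nat image_set0 supremum0. Qed.

Lemma sup_nat_max (P : set nat) (m : nat) :
  P m -> (forall k, P k -> (k <= m)%N) -> sup_nat P = (m%:Z)%:E.
Proof.
move=> Pm m_max; rewrite /sup_nat /supremum; set E := (X in X == set0).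
have Em : E (m%:Z)%:E by exists m.
rewrite ifF; last by apply/eqP => E0; rewrite E0 in Em.
apply: (@is_subset1_supremums _ _ E); last first.
  split=> [_ [k Pk <-]|x]; last exact.
  by rewrite lee_fin lez_nat; exact: m_max.
apply: xgetPex; exists (m%:Z)%:E; split=> [_ [k Pk <-]|x]; last exact.
by rewrite lee_fin lez_nat; exact: m_max.
Qed.

Lemma sup_nat_unbounded (P : set nat) :
  (forall m, exists2 k, P k & (m < k)%N) -> sup_nat P = +oo%E.
Proof.
move=> Punb; rewrite /sup_nat /supremum; set E := (X in X == set0).
have [k0 Pk0 _] := Punb 0.
have Ek0 : E (k0%:Z)%:E by exists k0.
rewrite ifF; last by apply/eqP => E0; rewrite E0 in Ek0.
have sup_oo : supremums E +oo%E.
  split=> [x _|x Ex]; first by rewrite leey.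
  case: x Ex => [z|//|] Ex.
  - have [k Pk kz] := Punb `|z|%N.
    have /Ex : E (k%:Z)%:E by exists k.
    rewrite lee_fin => /le_trans /(_ (lez_abs z)).
    by rewrite lez_nat leqNgt kz.
  - by have := Ex _ Ek0.
apply: (@is_subset1_supremums _ _ E) => //.
by apply: xgetPex; exists +oo%E.
Qed.

Lemma sup_nat_ge (P : set nat) (n : nat) :
  ((n%:Z)%:E <= sup_nat P)%E <-> exists2 m, P m & (n <= m)%N.
Proof.
have [Punb|] := pselect (forall m, exists2 k, P k & (m < k)%N).
  rewrite sup_nat_unbounded // leey; split=> // _.
  by have [k Pk /ltnW nk] := Punb n; exists k.
move=> /existsNP [b Pb].
have Pleb k : `[< P k >] -> (k <= b)%N.
  by move=> /asboolP Pk; rewrite leqNgt; apply/negP => bk; apply: Pb; exists k.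
have [[k Pk]|P0] := pselect (exists k, P k); last first.
  have -> : P = set0 by rewrite -subset0 => k Pk; apply: P0; exists k.
  by rewrite sup_nat0; split=> [|[]].
have exP : exists k, `[< P k >] by exists k; apply/asboolP.
have [m /asboolP Pm m_max] := ex_maxnP exP Pleb.
rewrite (@sup_nat_max P m) //; last by move=> j Pj; apply: m_max; apply/asboolP.
rewrite lee_fin lez_nat; split=> [nm|[j Pj nj]]; first by exists m.
by apply: (leq_trans nj); apply: m_max; apply/asboolP.
Qed.

Section Dimension.
Variable R : comPzRingType.

(* -oo for the zero ring. *)
Definition krull_dim : \bar int :=
  sup_nat [set n | exists c : nat -> set R,
    (forall i, (i <= n)%N -> is_prime (c i)) /\
    (forall i, (i < n)%N -> c i `<` c i.+1)].

Definition zero_dimensional : Prop := krull_dim = 0%E.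

Definition regular_seq (xs : seq R) : Prop :=
  (forall i, (i < size xs)%N -> forall r,
     ideal_gen (take i xs) (xs`_i * r) -> ideal_gen (take i xs) r) /\
  ~ ideal_gen xs 1.

(* The depth of a local ring R with maximal ideal m is depth m. *)
Definition depth (m : set R) : \bar int :=
  sup_nat [set n | exists xs : seq R,
    [/\ size xs = n, forall x, x \in xs -> m x & regular_seq xs]].

End Dimension.

Section Localization.
Variables (R : comPzRingType) (p : spec R).

Definition denom := {s : R | `[< ~ p s >]}.

Lemma denomP (s : denom) : ~ p (sval s).
Proof. by apply/asboolP; exact: (valP s). Qed.

Lemma denom1_subproof : `[< ~ p 1 >].
Proof. by apply/asboolP; case: (specP p). Qed.

Lemma denomM_subproof (s t : denom) : `[< ~ p (sval s * sval t) >].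
Proof.
by apply/asboolP; case: (specP p) => _ _ pM /pM [] /denomP.
Qed.

Definition denom1 : denom := exist _ 1 denom1_subproof.
Definition denomM (s t : denom) : denom :=
  exist _ (sval s * sval t) (denomM_subproof s t).

Definition frac_rel (x y : R * denom) : bool :=
  `[< exists u : denom, sval u * (x.1 * sval y.2) = sval u * (y.1 * sval x.2) >].

Lemma frac_rel_equiv : equiv_class_of frac_rel.
Proof.
split=> [x|x y|y x z].
- by apply/asboolP; exists denom1.
- by apply/asboolP/asboolP => -[u uE]; exists u.
- move=> /asboolP[u uE] /asboolP[v vE]; apply/asboolP.
  exists (denomM (denomM u v) y.2) => /=.
  have -> : sval u * sval v * sval y.2 * (x.1 * sval z.2) =
    sval v * sval z.2 * (sval u * (x.1 * sval y.2)) by ring.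
  rewrite uE.
  have -> : sval v * sval z.2 * (sval u * (y.1 * sval x.2)) =
    sval u * sval x.2 * (sval v * (y.1 * sval z.2)) by ring.
  by rewrite vE; ring.
Qed.

Canonical frac_rel_canonical := EquivRelPack frac_rel_equiv.

Definition localization := {eq_quot frac_rel}.

HB.instance Definition _ : EqQuotient _ frac_rel localization :=
  EqQuotient.on localization.
HB.instance Definition _ := Choice.on localization.

Definition frac (a : R) (s : denom) : localization := \pi_localization (a, s).

Lemma fracE (a b : R) (s t : denom) :
  frac a s = frac b t <-> exists u : denom,
    sval u * (a * sval t) = sval u * (b * sval s).
Proof.
split=> [/eqmodP /asboolP //|h]; by apply/eqmodP/asboolP.
Qed.

Lemma fracP (x : localization) : exists a s, x = frac a s.
Proof. by exists (repr x).1, (repr x).2; rewrite /frac -surjective_pairing reprK. Qed.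

Let addF (x y : R * denom) :=
  (x.1 * sval y.2 + y.1 * sval x.2, denomM x.2 y.2).
Let mulF (x y : R * denom) := (x.1 * y.1, denomM x.2 y.2).
Let oppF (x : R * denom) := (- x.1, x.2).

Definition loc_add (x y : localization) : localization :=
  \pi_localization (addF (repr x) (repr y)).
Definition loc_mul (x y : localization) : localization :=
  \pi_localization (mulF (repr x) (repr y)).
Definition loc_opp (x : localization) : localization :=
  \pi_localization (oppF (repr x)).

Lemma repr_frac a s : exists u : denom,
  sval u * ((repr (frac a s)).1 * sval s) = sval u * (a * sval (repr (frac a s)).2).
Proof. by apply/fracE; rewrite /frac -surjective_pairing reprK. Qed.

Lemma loc_addE a s b t : loc_add (frac a s) (frac b t) =
  frac (a * sval t + b * sval s) (denomM s t).
Proof.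
have [u uE] := repr_frac a s; have [v vE] := repr_frac b t.
rewrite /loc_add; move: (repr _) (repr _) uE vE => [y y'] [x x'] /= uE vE.
apply/fracE; exists (denomM u v) => /=.
transitivity ((sval u * (x * sval s)) * sval v * sval y' * sval t +
              (sval v * (y * sval t)) * sval u * sval x' * sval s); first by ring.
by rewrite uE vE; ring.
Qed.

Lemma loc_mulE a s b t :
  loc_mul (frac a s) (frac b t) = frac (a * b) (denomM s t).
Proof.
have [u uE] := repr_frac a s; have [v vE] := repr_frac b t.
rewrite /loc_mul; move: (repr _) (repr _) uE vE => [y y'] [x x'] /= uE vE.
apply/fracE; exists (denomM u v) => /=.
transitivity ((sval u * (x * sval s)) * (sval v * (y * sval t))); first by ring.
by rewrite uE vE; ring.
Qed.

Lemma loc_oppE a s : loc_opp (frac a s) = frac (- a) s.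
Proof.
have [u uE] := repr_frac a s.
rewrite /loc_opp; move: (repr _) uE => [x x'] /= uE.
apply/fracE; exists u => /=.
by rewrite !mulNr !mulrN uE.
Qed.

Lemma frac_eq a s b t : a * sval t = b * sval s -> frac a s = frac b t.
Proof. by move=> e; apply/fracE; exists denom1; rewrite e. Qed.

Lemma loc_addA : associative loc_add.
Proof.
move=> x y z; have [a [s ->]] := fracP x; have [b [t ->]] := fracP y.
have [c [u ->]] := fracP z.
by rewrite !loc_addE; apply: frac_eq => /=; ring.
Qed.

Lemma loc_addC : commutative loc_add.
Proof.
move=> x y; have [a [s ->]] := fracP x; have [b [t ->]] := fracP y.
by rewrite !loc_addE; apply: frac_eq => /=; ring.
Qed.

Lemma loc_add0 : left_id (frac 0 denom1) loc_add.
Proof.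
move=> x; have [a [s ->]] := fracP x.
by rewrite !loc_addE; apply: frac_eq => /=; ring.
Qed.

Lemma loc_addN : left_inverse (frac 0 denom1) loc_opp loc_add.
Proof.
move=> x; have [a [s ->]] := fracP x.
by rewrite loc_oppE loc_addE; apply: frac_eq => /=; ring.
Qed.

HB.instance Definition _ :=
  GRing.isZmodule.Build localization loc_addA loc_addC loc_add0 loc_addN.

Lemma loc_mulA : associative loc_mul.
Proof.
move=> x y z; have [a [s ->]] := fracP x; have [b [t ->]] := fracP y.
have [c [u ->]] := fracP z.
by rewrite !loc_mulE; apply: frac_eq => /=; ring.
Qed.

Lemma loc_mulC : commutative loc_mul.
Proof.
move=> x y; have [a [s ->]] := fracP x; have [b [t ->]] := fracP y.
by rewrite !loc_mulE; apply: frac_eq => /=; ring.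
Qed.

Lemma loc_mul1 : left_id (frac 1 denom1) loc_mul.
Proof.
move=> x; have [a [s ->]] := fracP x.
by rewrite !loc_mulE; apply: frac_eq => /=; ring.
Qed.

Lemma loc_mulD : left_distributive loc_mul loc_add.
Proof.
move=> x y z; have [a [s ->]] := fracP x; have [b [t ->]] := fracP y.
have [c [u ->]] := fracP z.
by rewrite !(loc_mulE, loc_addE); apply: frac_eq => /=; ring.
Qed.

Lemma loc_1_neq0 : frac 1 denom1 != 0.
Proof.
apply/eqP => /fracE [u] /=; rewrite !mulr1 mulr0 => u0.
apply: (@denomP u); rewrite u0.
by case: (specP p) => -[].
Qed.

HB.instance Definition _ := GRing.Zmodule_isComNzRing.Build localization
  loc_mulA loc_mulC loc_mul1 loc_mulD loc_1_neq0.

Lemma frac0 : frac 0 denom1 = 0. Proof. by []. Qed.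
Lemma frac1 : frac 1 denom1 = 1. Proof. by []. Qed.
Lemma fracD a s b t :
  frac a s + frac b t = frac (a * sval t + b * sval s) (denomM s t).
Proof. exact: loc_addE. Qed.
Lemma fracM a s b t : frac a s * frac b t = frac (a * b) (denomM s t).
Proof. exact: loc_mulE. Qed.
Lemma fracN a s : - frac a s = frac (- a) s.
Proof. exact: loc_oppE. Qed.

Definition to_loc (a : R) : localization := frac a denom1.

Lemma to_loc_zmod_morphism : zmod_morphism to_loc.
Proof.
by move=> a b; rewrite /to_loc fracN fracD; apply: frac_eq => /=; ring.
Qed.

Lemma to_loc_monoid_morphism : monoid_morphism to_loc.
Proof.
by split=> // a b; rewrite /to_loc fracM; apply: frac_eq => /=; ring.
Qed.

HB.instance Definition _ :=
  GRing.isZmodMorphism.Build R localization to_loc to_loc_zmod_morphism.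
HB.instance Definition _ :=
  GRing.isMonoidMorphism.Build R localization to_loc to_loc_monoid_morphism.

(* The maximal ideal pR_p, first as a set, then as a library ideal. *)
Definition loc_max : set localization :=
  [set x | exists a s, p a /\ x = frac a s].

Definition loc_maxb : {pred localization} := [pred x | `[< loc_max x >]].

Lemma loc_max_idealr : idealr_closed loc_maxb.
Proof.
case: (specP p) => -[p0 pD pM] p1 pP.
split.
- by apply/asboolP; exists 0, denom1.
- apply/asboolP => -[a [s [pa /fracE [u /=]]]].
  rewrite mul1r mulr1 => e; have : p (sval u * a) by exact: pM.
  by rewrite -e => /pP [] /denomP.
move=> x y z /asboolP [a [s [pa ->]]] /asboolP [b [t [pb ->]]].
have [c [u ->]] := fracP x.
apply/asboolP; rewrite fracM fracD; do 2 eexists; split; last by [].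
apply: pD; first by rewrite mulrC; exact: pM (pM _ _ pa).
by rewrite mulrC; apply: pM.
Qed.

HB.instance Definition _ := isIdealr.Build localization loc_maxb loc_max_idealr.

Definition residue_field := {ideal_quot loc_maxb}.

HB.instance Definition _ := GRing.ComNzRing.on residue_field.

Definition to_residue (a : R) : residue_field :=
  \pi_{ideal_quot loc_maxb} (to_loc a).

Lemma to_residue_zmod_morphism : zmod_morphism to_residue.
Proof. by move=> a b; rewrite /to_residue !rmorphB. Qed.

Lemma to_residue_monoid_morphism : monoid_morphism to_residue.
Proof.
by split=> [|a b]; rewrite /to_residue ?rmorph1 ?rmorphM.
Qed.

HB.instance Definition _ :=
  GRing.isZmodMorphism.Build R residue_field to_residue to_residue_zmod_morphism.
HB.instance Definition _ :=
  GRing.isMonoidMorphism.Build R residue_field to_residue to_residue_monoid_morphism.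

End Localization.

Definition serre (n : nat) (R : comPzRingType) : Prop :=
  noetherian R /\
  forall p : spec R,
    (Order.min (n%:Z)%:E (krull_dim (localization p)) <= depth (@loc_max R p))%E.

(* The tensor product of A-modules: formal sums of pairs (m, n), written as
   lists, modulo the congruence generated by bilinearity. *)
Section Tensor.
Variables (A : comPzRingType) (M N : lmodType A).

Inductive tensor_cong : seq (M * N) -> seq (M * N) -> Prop :=
| TensorRefl s : tensor_cong s s
| TensorSym s t : tensor_cong s t -> tensor_cong t s
| TensorTrans s t u : tensor_cong s t -> tensor_cong t u -> tensor_cong s u
| TensorCat s s' t t' :
    tensor_cong s s' -> tensor_cong t t' -> tensor_cong (s ++ t) (s' ++ t')
| TensorComm s t : tensor_cong (s ++ t) (t ++ s)
| TensorZero n : tensor_cong [:: (0, n)] [::]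
| TensorDl m m' n : tensor_cong [:: (m + m', n)] [:: (m, n); (m', n)]
| TensorDr m n n' : tensor_cong [:: (m, n + n')] [:: (m, n); (m, n')]
| TensorZ a m n : tensor_cong [:: (a *: m, n)] [:: (m, a *: n)].

Definition tensor_rel (s t : seq (M * N)) : bool := `[< tensor_cong s t >].

Lemma tensor_rel_equiv : equiv_class_of tensor_rel.
Proof.
split=> [s|s t|t s u].
- by apply/asboolP; exact: TensorRefl.
- by apply/asboolP/asboolP; exact: TensorSym.
- by move=> /asboolP st /asboolP tu; apply/asboolP; exact: TensorTrans tu.
Qed.

Canonical tensor_rel_canonical := EquivRelPack tensor_rel_equiv.

Definition tensor := {eq_quot tensor_rel}.

HB.instance Definition _ : EqQuotient _ tensor_rel tensor :=
  EqQuotient.on tensor.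
HB.instance Definition _ := Choice.on tensor.

Definition tensor_class (s : seq (M * N)) : tensor := \pi_tensor s.

Lemma tensor_classE s t : tensor_class s = tensor_class t <-> tensor_cong s t.
Proof. by split=> [/eqmodP /asboolP //|h]; apply/eqmodP/asboolP. Qed.

Lemma tensor_classK (x : tensor) : tensor_class (repr x) = x.
Proof. exact: reprK. Qed.

Lemma tensor_repr s : tensor_cong (repr (tensor_class s)) s.
Proof. by apply/tensor_classE; rewrite tensor_classK. Qed.

Let oppS (s : seq (M * N)) := [seq (- x.1, x.2) | x <- s].

Definition tensor_add (x y : tensor) : tensor :=
  tensor_class (repr x ++ repr y).
Definition tensor_opp (x : tensor) : tensor := tensor_class (oppS (repr x)).

Lemma tensor_addE s t :
  tensor_add (tensor_class s) (tensor_class t) = tensor_class (s ++ t).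
Proof. by apply/tensor_classE; apply: TensorCat; exact: tensor_repr. Qed.

Lemma tensor_addA : associative tensor_add.
Proof.
move=> x y z; rewrite -[x]tensor_classK -[y]tensor_classK -[z]tensor_classK.
by rewrite !tensor_addE catA.
Qed.

Lemma tensor_addC : commutative tensor_add.
Proof.
move=> x y; rewrite -[x]tensor_classK -[y]tensor_classK.
by rewrite !tensor_addE; apply/tensor_classE; exact: TensorComm.
Qed.

Lemma tensor_add0 : left_id (tensor_class [::]) tensor_add.
Proof. by move=> x; rewrite -[x]tensor_classK !tensor_addE. Qed.

Lemma tensor_oppS s : tensor_cong (oppS s ++ s) [::].
Proof.
apply/tensor_classE; elim: s => //= -[m n] s IH.
transitivity (tensor_add
  (tensor_add (tensor_class [:: (- m, n)]) (tensor_class (oppS s)))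
  (tensor_add (tensor_class s) (tensor_class [:: (m, n)]))).
  by rewrite (tensor_addC (tensor_class s)) !tensor_addE.
rewrite -tensor_addA (tensor_addA (tensor_class (oppS s))).
rewrite (tensor_addE (oppS s)) IH !tensor_addE.
apply/tensor_classE/(@TensorTrans _ [:: (- m + m, n)]).
  exact/TensorSym/TensorDl.
by rewrite addNr; exact: TensorZero.
Qed.

Lemma tensor_addN : left_inverse (tensor_class [::]) tensor_opp tensor_add.
Proof.
move=> x; rewrite -{2}[x]tensor_classK /tensor_opp tensor_addE.
exact/tensor_classE/tensor_oppS.
Qed.

HB.instance Definition _ := GRing.isZmodule.Build tensor
  tensor_addA tensor_addC tensor_add0 tensor_addN.

Definition tens (m : M) (n : N) : tensor := tensor_class [:: (m, n)].

Lemma tensor_class_sum s : tensor_class s = \sum_(x <- s) tens x.1 x.2.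
Proof.
elim: s => [|[m n] s IH]; first by rewrite big_nil.
by rewrite big_cons -IH -cat1s -tensor_addE.
Qed.

Lemma tensP (x : tensor) : exists s, x = \sum_(y <- s) tens y.1 y.2.
Proof. by exists (repr x); rewrite -tensor_class_sum tensor_classK. Qed.

Lemma tensor_ind (P : tensor -> Prop) :
  P 0 -> (forall m n, P (tens m n)) ->
  (forall x y, P x -> P y -> P (x + y)) -> forall x, P x.
Proof.
move=> P0 Pt PD x; have [s ->] := tensP x.
by elim/big_rec: _ => // y z _ Pz; apply: PD.
Qed.

Lemma tensDl m m' n : tens (m + m') n = tens m n + tens m' n.
Proof.
rewrite [RHS]tensor_addE; exact/tensor_classE/TensorDl.
Qed.

Lemma tensDr m n n' : tens m (n + n') = tens m n + tens m n'.
Proof.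
rewrite [RHS]tensor_addE; exact/tensor_classE/TensorDr.
Qed.

Lemma tensZ a m n : tens (a *: m) n = tens m (a *: n).
Proof. exact/tensor_classE/TensorZ. Qed.

Lemma tens0l n : tens 0 n = 0.
Proof. exact/tensor_classE/TensorZero. Qed.

Lemma tensor_cong_lift (V : zmodType) (phi : M -> N -> V) :
  (forall m m' n, phi (m + m') n = phi m n + phi m' n) ->
  (forall m n n', phi m (n + n') = phi m n + phi m n') ->
  (forall a m n, phi (a *: m) n = phi m (a *: n)) ->
  forall s t, tensor_cong s t ->
  \sum_(x <- s) phi x.1 x.2 = \sum_(x <- t) phi x.1 x.2.
Proof.
move=> phiDl phiDr phiZ s t; elim=> {s t}.
- by [].
- by move=> s t _ ->.
- by move=> s t u _ -> _ ->.
- by move=> s s' t t' _ ss' _ tt'; rewrite !big_cat /= ss' tt'.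
- by move=> s t; rewrite !big_cat /= addrC.
- move=> n; rewrite big_seq1 big_nil /=.
  by apply: (addrI (phi 0 n)); rewrite -phiDl !addr0.
- by move=> m m' n; rewrite big_seq1 !big_cons big_nil addr0 /=.
- by move=> m n n'; rewrite big_seq1 !big_cons big_nil addr0 /=.
- by move=> a m n; rewrite !big_seq1 /=.
Qed.

Lemma tensor_lift (V : zmodType) (phi : M -> N -> V) :
  (forall m m' n, phi (m + m') n = phi m n + phi m' n) ->
  (forall m n n', phi m (n + n') = phi m n + phi m n') ->
  (forall a m n, phi (a *: m) n = phi m (a *: n)) ->
  exists g : tensor -> V,
    {morph g : x y / x + y} /\ forall m n, g (tens m n) = phi m n.
Proof.
move=> phiDl phiDr phiZ.
have H := tensor_cong_lift phiDl phiDr phiZ.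
exists (fun x => \sum_(y <- repr x) phi y.1 y.2); split=> [x y|m n].
  rewrite -{1}[x]tensor_classK -{1}[y]tensor_classK [_ + _]tensor_addE.
  by rewrite (H _ _ (tensor_repr _)) big_cat.
by rewrite (H _ _ (tensor_repr _)) big_seq1.
Qed.

End Tensor.

(* B as a module over A along f : A -> B. *)
Definition restrict (A B : comPzRingType) (f : {rmorphism A -> B}) : Type := B.

Section Restrict.
Variables (A B : comPzRingType) (f : {rmorphism A -> B}).

HB.instance Definition _ := GRing.Zmodule.on (restrict f).

Definition restrict_scale (a : A) (b : restrict f) : restrict f :=
  f a * (b : B).

Lemma restrict_scaleA a b (x : restrict f) :
  restrict_scale a (restrict_scale b x) = restrict_scale (a * b) x.
Proof. by rewrite /restrict_scale rmorphM mulrA. Qed.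

Lemma restrict_scale1 : left_id 1 restrict_scale.
Proof. by move=> x; rewrite /restrict_scale rmorph1 mul1r. Qed.

Lemma restrict_scaleDr : right_distributive restrict_scale +%R.
Proof. by move=> a x y; exact: mulrDr. Qed.

Lemma restrict_scaleDl (x : restrict f) :
  {morph restrict_scale^~ x : a b / a + b}.
Proof. by move=> a b; rewrite /restrict_scale rmorphD; exact: mulrDl. Qed.

HB.instance Definition _ := GRing.Zmodule_isLmodule.Build A (restrict f)
  restrict_scaleA restrict_scale1 restrict_scaleDr restrict_scaleDl.

End Restrict.

Definition pure (A B : comPzRingType) (f : {rmorphism A -> B}) : Prop :=
  forall W : lmodType A, injective (fun w : W => tens (1 : restrict f) w).

(* The tensor product of two commutative A-algebras, as a ring. *)
Definition tensor_alg (A B C : comPzRingType) (f : {rmorphism A -> B})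
  (g : {rmorphism A -> C}) : Type := tensor (restrict f) (restrict g).

Section TensorAlg.
Variables (A B C : comPzRingType).
Variables (f : {rmorphism A -> B}) (g : {rmorphism A -> C}).
Local Notation T := (tensor_alg f g).

HB.instance Definition _ := GRing.Zmodule.on T.

Let tn (b : B) (c : C) : T := @tens A (restrict f) (restrict g) b c.

Let mulS (s t : seq (restrict f * restrict g)) : T :=
  \sum_(x <- s) \sum_(y <- t) tn ((x.1 : B) * y.1) ((x.2 : C) * y.2).

Definition tensor_mul (x y : T) : T := mulS (repr x) (repr y).

Let mulSl s s' t : tensor_cong s s' -> mulS s t = mulS s' t.
Proof.
move=> ss'; apply: (@tensor_cong_lift _ _ _ _
  (fun (b : restrict f) (c : restrict g) =>
     \sum_(y <- t) tn ((b : B) * y.1) ((c : C) * y.2))) ss'.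
- move=> m m' n; rewrite -big_split; apply: eq_bigr => y _ /=.
  by rewrite -[RHS]tensDl; congr tens; exact: mulrDl.
- move=> m n n'; rewrite -big_split; apply: eq_bigr => y _ /=.
  by rewrite -[RHS]tensDr; congr tens; exact: mulrDl.
- move=> a m n; apply: eq_bigr => y _.
  rewrite /tn -[in RHS](mulrA (g a)) -[LHS]/(tens _ _) -[in LHS](mulrA (f a)).
  exact: tensZ.
Qed.

Let mulSC s t : mulS s t = mulS t s.
Proof.
rewrite /mulS exchange_big; apply: eq_bigr => x _; apply: eq_bigr => y _ /=.
by rewrite mulrC [in X in tn _ X]mulrC.
Qed.

Lemma tensor_mulE s t :
  tensor_mul (tensor_class s) (tensor_class t) = mulS s t.
Proof.
rewrite /tensor_mul (mulSl _ (tensor_repr _)) mulSC.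
by rewrite (mulSl _ (tensor_repr _)) mulSC.
Qed.

Lemma tensor_mul_tens b c b' c' : tensor_mul (tn b c) (tn b' c') =
  tn (b * b') (c * c').
Proof. by rewrite tensor_mulE /mulS !big_seq1. Qed.

Lemma tensor_mulC : commutative tensor_mul.
Proof. by move=> x y; exact: mulSC. Qed.

Lemma tensor_mulDl : left_distributive tensor_mul +%R.
Proof.
move=> x y z; rewrite -[x]tensor_classK -[y]tensor_classK -[z]tensor_classK.
rewrite [X in tensor_mul X _]tensor_addE !tensor_mulE.
exact: big_cat.
Qed.

Lemma tensor_mulDr : right_distributive tensor_mul +%R.
Proof. by move=> x y z; rewrite !(tensor_mulC x) tensor_mulDl. Qed.

Lemma tensor_mul1 : left_id (tn 1 1) tensor_mul.
Proof.
move=> x; elim/tensor_ind: x => [|m n|x y xE yE].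
- by apply: (addrI (tensor_mul (tn 1 1) 0)); rewrite -tensor_mulDr !addr0.
- rewrite -[tens m n]/(tn m n) tensor_mul_tens; congr tn; exact: mul1r.
- by rewrite tensor_mulDr xE yE.
Qed.

Let tensor_mul0 (x : T) : tensor_mul x 0 = 0.
Proof. by apply: (addrI (tensor_mul x 0)); rewrite -tensor_mulDr !addr0. Qed.

Lemma tensor_mulA : associative tensor_mul.
Proof.
move=> x y z; elim/tensor_ind: x => [|b c|x x' xE x'E].
- by rewrite !(tensor_mulC 0) !tensor_mul0 tensor_mulC tensor_mul0.
- elim/tensor_ind: y => [|b' c'|y y' yE y'E].
  + by rewrite !(tensor_mulC 0) !tensor_mul0 !(tensor_mulC 0) tensor_mul0.
  + elim/tensor_ind: z => [|b'' c''|z z' zE z'E].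
    * by rewrite !tensor_mul0.
    * by rewrite !tensor_mul_tens !mulrA.
    * by rewrite !tensor_mulDr zE z'E.
  + by rewrite !(tensor_mulDl, tensor_mulDr) yE y'E.
- by rewrite !tensor_mulDl xE x'E.
Qed.

HB.instance Definition _ := GRing.Zmodule_isComPzRing.Build T
  tensor_mulA tensor_mulC tensor_mul1 tensor_mulDl.

Lemma tensM (b b' : B) (c c' : C) :
  (tn b c : T) * tn b' c' = tn (b * b') (c * c').
Proof. exact: tensor_mul_tens. Qed.

End TensorAlg.

Definition fiber_ring (A B : comPzRingType) (f : {rmorphism A -> B})
  (p : spec A) : comPzRingType := tensor_alg f (@to_residue A p).

(* Main.v *)
From HB Require Import structures.
Require Import Defs.
From mathcomp Require Import all_boot all_order all_algebra.
From mathcomp Require Import boolp classical_sets constructive_ereal.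
From mathcomp Require Import ring.

(** Write [K_i] for the ideal of [B] generated by the images of [x_1, .., x_i],
and [J_i] for the ideal of [A] that [x_1, .., x_i] generate.

For a prime [p] of [A] and [k <= min n (dim A_p)], a regular sequence
[x_1, .., x_k] of [A_p] is chosen inside [p], one element at a time: [x_i] lies
outside every associated prime [P] of [B / K_(i-1)] whose preimage in [A] does
not contain [p] (prime avoidance; [assoc_finite] says that there are finitely
many such [P]). Let [q] be a prime of [B] over [p]. Since the fiber over [p] has
dimension zero, no prime strictly below [q] lies over [p]
([fiber_incomparable]). Hence an associated prime of [B / K_(i-1)] that is
contained in [q] and contains [x_i] is [q] itself: [x_i] is regular on
[B_q / K_(i-1)] as long as this ring has positive depth. When the depth drops to
zero before step [n], the images of the [x_j] form a maximal regular sequence of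
[B_q], so by Serre's condition their number is [dim B_q] and [K_(i-1)] contains
a power of [q B_q]. This is [generic_dichotomy]: at every [q] over [p], either
[B_q / K_(i-1)] has positive depth, and then [x_i] is regular on it, or [p] is
nilpotent modulo [K_(i-1) B_q].

Purity brings regularity down to [A_p] ([generic_regular_at_descent]). Suppose
that [x_i c] lies in [J_(i-1)] and that [c] does not, locally at [p]. By Krull's
height theorem [J_(i-1)] lies in a prime [Q] strictly below [p], for
[i - 1 < dim A_p]; take [a] in [p] outside [Q], so that no power of [a] lies in
[J_(i-1)] locally at [p]. At a prime [q] of the first kind [c] becomes zero in
[B_q / K_(i-1)], at one of the second kind a power [a^N] does, and [N] can be
chosen independently of [q]. Purity with respect to cyclic modules would only
give one prime for [c] and another for [a^N]. Purity with respect to an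
amalgam of two quotients of [A / J_(i-1)], in which [c] and [a^N] are
identified with one element of annihilator [p], gives a single prime [q] over
[p] at which neither vanishes ([amalgam]), a contradiction.

The remaining parts supply the commutative algebra: all maximal regular
sequences have the same length ([depth_ge_at_adjoin]), a regular sequence bounds
the height from below ([regseq_at_chain]), and Krull's height theorem
([principal_ideal], [chain_adjoins]). *)

Set Implicit Arguments.
Unset Strict Implicit.
Unset Printing Implicit Defensive.

(* [frac] means a fraction of a localization, not of a field of fractions. *)
Import Defs.
Import Order.TTheory GRing.Theory Num.Theory.

Local Open Scope classical_set_scope.
Local Open Scope quotient_scope.
Local Open Scope ring_scope.

(** * Ideals, primes and associated primes *)

Section Ideals.
Variable R : comPzRingType.
Implicit Types (I J K : set R) (x y r : R) (xs : seq R).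

Definition adjoin K x : set R := [set y | exists k r, K k /\ y = k + r * x].
Definition adjoins K xs : set R := foldl adjoin K xs.
Definition colon K c : set R := [set b | K (b * c)].

(** For [K] an ideal and [q] a prime, the contraction to [R] of the ideal that [K]
generates in the local ring at [q]. Statements about that local ring are
phrased inside [R] by means of it. *)
Definition sat (q K : set R) : set R := [set r | exists u, ~ q u /\ K (u * r)].

Lemma is_ideal0 : is_ideal [set 0 : R].
Proof.
split=> [//|x y /= -> ->|a x /= ->]; by rewrite ?addr0 ?mulr0.
Qed.

Section One.
Variables (K : set R).
Hypothesis idK : is_ideal K.

Lemma id0 : K 0. Proof. by case: idK. Qed.
Lemma idD x y : K x -> K y -> K (x + y). Proof. by case: idK => _ h _; exact: h. Qed.
Lemma idMl a x : K x -> K (a * x). Proof. by case: idK => _ _ h; exact: h. Qed.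
Lemma idMr a x : K x -> K (x * a). Proof. by rewrite mulrC; exact: idMl. Qed.
Lemma idN x : K x -> K (- x). Proof. by move=> /(idMl (-1)); rewrite mulN1r. Qed.
Lemma idB x y : K x -> K y -> K (x - y). Proof. by move=> ? /idN; exact: idD. Qed.

Lemma is_ideal_adjoin x : is_ideal (adjoin K x).
Proof.
split.
- by exists 0, 0; split; [exact: id0|ring].
- move=> _ _ [k [r [Kk ->]]] [k' [r' [Kk' ->]]].
  by exists (k + k'), (r + r'); split; [exact: idD|ring].
- move=> a _ [k [r [Kk ->]]]; exists (a * k), (a * r).
  by split; [exact: idMl|ring].
Qed.

Lemma is_ideal_colon c : is_ideal (colon K c).
Proof.
split; rewrite /colon /=.
- by rewrite mul0r; exact: id0.
- by move=> x y ? ?; rewrite mulrDl; exact: idD.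
- by move=> a x ?; rewrite -mulrA; exact: idMl.
Qed.

Lemma adjoin_self x : adjoin K x x.
Proof. by exists 0, 1; split; [exact: id0|ring]. Qed.

Lemma adjoinM r x : adjoin K x (r * x).
Proof. by exists 0, r; split; [exact: id0|ring]. Qed.

End One.

Lemma sub_adjoin K x : K `<=` adjoin K x.
Proof. by move=> k Kk; exists k, 0; split=> //; ring. Qed.

Lemma adjoin_sub K J x : is_ideal J -> K `<=` J -> J x -> adjoin K x `<=` J.
Proof.
move=> idJ KJ Jx _ [k [r [Kk ->]]].
by apply: idD => //; [exact: KJ|exact: idMl].
Qed.

Lemma adjoinC K x y : adjoin (adjoin K x) y = adjoin (adjoin K y) x.
Proof.
have sub a b : adjoin (adjoin K a) b `<=` adjoin (adjoin K b) a.
  move=> _ [_ [r [[k [s [Kk ->]]] ->]]]; exists (k + r * b), s.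
  by split; [exists k, r|ring].
by rewrite eqEsubset; split.
Qed.

Lemma is_ideal_adjoins K xs : is_ideal K -> is_ideal (adjoins K xs).
Proof. by elim: xs K => //= x xs IH K idK; apply/IH/is_ideal_adjoin. Qed.

Lemma sub_adjoins K xs : K `<=` adjoins K xs.
Proof.
elim: xs K => [|x xs IH] K /=; first exact: subset_refl.
by apply: subset_trans (IH _); exact: sub_adjoin.
Qed.

Lemma adjoins_sub K J xs : is_ideal J -> K `<=` J ->
  (forall x, x \in xs -> J x) -> adjoins K xs `<=` J.
Proof.
move=> idJ; elim: xs K => //= x xs IH K KJ xsJ; apply: IH.
  by apply: adjoin_sub => //; apply: xsJ; rewrite mem_head.
by move=> y yxs; apply: xsJ; rewrite inE yxs orbT.
Qed.

Lemma adjoins_rcons K xs x : adjoins K (rcons xs x) = adjoin (adjoins K xs) x.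
Proof. by rewrite /adjoins foldl_rcons. Qed.

Lemma adjoins_mem K xs x : is_ideal K -> x \in xs -> adjoins K xs x.
Proof.
elim: xs K => //= y xs IH K idK; rewrite inE => /orP[/eqP ->|xxs].
  by apply: (sub_adjoins (K := adjoin K y)); exact: adjoin_self.
by apply: IH => //; exact: is_ideal_adjoin.
Qed.

Lemma ideal_genE xs : ideal_gen xs = adjoins [set 0] xs.
Proof.
rewrite predeqE => z; split.
  move=> [c _ <-]; have idJ := is_ideal_adjoins xs is_ideal0.
  elim/big_ind: _; [exact: id0|exact: idD|move=> i _].
  by apply: idMl => //; apply: adjoins_mem => //; [exact: is_ideal0|exact: mem_nth].
elim/last_ind: xs z => [|xs x IH] z.
  move=> /= ->; exists (fun=> 0) => //; by rewrite big_ord0.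
rewrite adjoins_rcons => -[k [r [/IH [c _ <-] ->]]].
exists (fun i => oapp c r (insub (nat_of_ord i))) => //.
rewrite size_rcons big_ord_recr /=; congr (_ + _).
  apply: eq_bigr => i _; rewrite nth_rcons ltn_ord /=.
  by rewrite (valK i).
by rewrite nth_rcons ltnn eqxx insubF ?ltnn.
Qed.

Lemma prime_ideal (P : set R) : is_prime P -> is_ideal P.
Proof. by case. Qed.

Lemma primeM (P : set R) x y : is_prime P -> ~ P x -> ~ P y -> ~ P (x * y).
Proof. by case=> _ _ h ? ? /h []. Qed.

Lemma prime1 (P : set R) : is_prime P -> ~ P 1.
Proof. by case. Qed.

Lemma primeX (P : set R) x n : is_prime P -> ~ P x -> ~ P (x ^+ n).
Proof.
move=> pP Px; elim: n => [|n IH]; first by rewrite expr0; exact: prime1.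
by rewrite exprS; exact: primeM.
Qed.

Lemma is_ideal_sat (q K : set R) : is_prime q -> is_ideal K -> is_ideal (sat q K).
Proof.
move=> pq idK; split.
- by exists 1; rewrite mulr0; split; [exact: prime1|exact: id0].
- move=> x y [u [qu Ku]] [v [qv Kv]]; exists (u * v); split; first exact: primeM.
  have -> : u * v * (x + y) = v * (u * x) + u * (v * y) by ring.
  by apply: idD => //; exact: idMl.
- move=> a x [u [qu Ku]]; exists u; split=> //; rewrite mulrCA; exact: idMl.
Qed.

Lemma sub_sat (q K : set R) : is_prime q -> K `<=` sat q K.
Proof. by move=> pq x Kx; exists 1; rewrite mul1r; split=> //; exact: prime1. Qed.

Lemma sat_unit (q K : set R) u x : is_prime q -> ~ q u -> sat q K (u * x) -> sat q K x.
Proof.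
move=> pq qu [v [qv Kv]]; exists (v * u); rewrite -mulrA; split=> //; exact: primeM.
Qed.

Lemma sat_mono (q K J : set R) : K `<=` J -> sat q K `<=` sat q J.
Proof. by move=> KJ x [u [qu Ku]]; exists u; split=> //; exact: KJ. Qed.

End Ideals.

Lemma prime_preimage (R S : comPzRingType) (g : {rmorphism R -> S}) (P : set S) :
  is_prime P -> is_prime [set a | P (g a)].
Proof.
move=> pP; have idP := prime_ideal pP; split; first split=> /=.
- by rewrite rmorph0; exact: id0.
- by move=> x y; rewrite rmorphD; exact: idD.
- by move=> a x; rewrite rmorphM; exact: idMl.
- by rewrite /= rmorph1; exact: prime1.
- by move=> x y /=; rewrite rmorphM; case: pP => _ _; apply.
Qed.

Section Noetherian.
Variable R : comPzRingType.
Hypothesis nR : noetherian R.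
Implicit Types (I J K : set R).

Lemma noeth_chain (c : nat -> set R) : (forall n, is_ideal (c n)) ->
  (forall n, c n `<=` c n.+1) -> exists n, forall m, c m `<=` c n.
Proof.
move=> idc cS.
have cle m n : (m <= n)%N -> c m `<=` c n.
  elim: n => [|n IH]; first by rewrite leqn0 => /eqP ->.
  rewrite leq_eqVlt => /orP[/eqP -> //|/IH h]; exact: subset_trans h (cS n).
pose U := [set x | exists n, c n x].
have idU : is_ideal U.
  split; first by exists 0%N; exact: id0.
    move=> x y [m cx] [n cy]; exists (maxn m n).
    by apply: idD => //; [apply: cle cx|apply: cle cy]; rewrite ?leq_maxl ?leq_maxr.
  by move=> a x [m cx]; exists m; exact: idMl.
have [xs UE] := nR idU; rewrite ideal_genE in UE.
have h x : x \in xs -> exists n, c n x.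
  by move=> xxs; suff: U x by []; rewrite UE; apply: adjoins_mem => //; exact: is_ideal0.
have {h} [n hn] : exists n, forall x, x \in xs -> c n x.
  elim: xs h {UE} => [|x xs IH] h; first by exists 0%N.
  have [m cm] := h x (mem_head _ _).
  have [y yxs|n cn] := IH; first by apply: h; rewrite inE yxs orbT.
  exists (maxn m n) => y; rewrite inE => /orP[/eqP ->|/cn].
    by apply: cle cm; rewrite leq_maxl.
  by apply: cle; rewrite leq_maxr.
exists n => m x cx; have : U x by exists m.
rewrite UE; apply: adjoins_sub => // _ ->; exact: id0.
Qed.

(** Otherwise strict enlargements could be iterated from [I0], against
[noeth_chain]. *)
Lemma noeth_max (F : set (set R)) I0 : (forall I, F I -> is_ideal I) -> F I0 ->
  exists I, [/\ F I, I0 `<=` I & forall J, F J -> I `<=` J -> J `<=` I].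
Proof.
move=> idF F0; apply: contrapT => noM.
have step I : exists J, F I -> I0 `<=` I -> [/\ F J, I `<=` J & ~ J `<=` I].
  have [[FI I0I]|h] := pselect (F I /\ I0 `<=` I); last first.
    by exists I => ? ?; case: h.
  apply: contrapT => h; apply: noM; exists I; split=> // J FJ IJ.
  by apply: contrapT => JI; apply: h; exists J.
have [g gP] := choice step.
pose c n := iter n g I0.
have cP n : F (c n) /\ I0 `<=` c n.
  elim: n => [|n [Fc Ic]]; first by split=> //; exact: subset_refl.
  have [FJ IJ _] := gP _ Fc Ic.
  by split=> //; exact: subset_trans Ic IJ.
have [n cn] : exists n, forall m, c m `<=` c n.
  apply: noeth_chain => n; first by apply: idF; case: (cP n).
  by have [Fc Ic] := cP n; have [] := gP _ Fc Ic.
by have [Fc Ic] := cP n; have [_ _] := gP _ Fc Ic; apply; exact: (cn n.+1).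
Qed.

Definition multiplicative (T : set R) := T 1 /\ forall s t, T s -> T t -> T (s * t).

Lemma mult_primeC (q : set R) : is_prime q -> multiplicative (~` q).
Proof.
by move=> pq; split=> [|s t /= qs qt]; [exact: prime1|exact: primeM].
Qed.

(** An ideal maximal among those containing [I0] and disjoint from [T] is prime. *)
Lemma prime_disjoint (T : set R) I0 : multiplicative T -> is_ideal I0 ->
  (forall t, T t -> ~ I0 t) ->
  exists P, [/\ is_prime P, I0 `<=` P & forall t, T t -> ~ P t].
Proof.
move=> [T1 TM] id0 dis.
have [|//|P [[idP Pdis] IP Pmax]] := @noeth_max
  [set I | is_ideal I /\ forall t, T t -> ~ I t] I0; first by move=> ? [].
exists P; split=> //; split=> //; first exact: Pdis.
move=> x y Pxy; apply: contrapT => /not_orP [Px Py].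
have h z : ~ P z -> exists t, T t /\ adjoin P z t.
  move=> Pz; apply: contrapT => /forallNP h; apply: Pz.
  apply: (Pmax (adjoin P z)); [split|exact: sub_adjoin|exact: adjoin_self].
    exact: is_ideal_adjoin.
  by move=> t Tt Pt; apply: (h t).
have [s [Ts [k [r [Pk sE]]]]] := h _ Px.
have [t [Tt [k' [r' [Pk' tE]]]]] := h _ Py.
apply: (Pdis (s * t)); first exact: TM.
rewrite sE tE.
have -> : (k + r * x) * (k' + r' * y) =
  (k' + r' * y) * k + (r * x) * k' + r * r' * (x * y)
  by ring.
by apply: idD => //; [apply: idD => //|]; exact: idMl.
Qed.

(** The annihilator of a multiple of [c] modulo [K] is prime when it is maximal
among those disjoint from [T]: if [y z] annihilates [b c] and some [t] in [T]
annihilates [y b c], then [y] annihilates [t b c], whose annihilator is no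
larger than that of [b c]. With [T] the complement of a prime [q], this
produces an associated prime contained in [q]. *)
Lemma assoc_prime (T : set R) K c : multiplicative T -> is_ideal K ->
  (forall t, T t -> ~ K (t * c)) ->
  exists b, is_prime (colon K (b * c)) /\ forall t, T t -> ~ colon K (b * c) t.
Proof.
move=> [T1 TM] idK dis.
have [||P [[b PE Pdis] _ Pmax]] := @noeth_max
  [set I | exists2 b, I = colon K (b * c) & forall t, T t -> ~ I t] (colon K (1 * c)).
- by move=> _ [b -> _]; exact: is_ideal_colon.
- by exists 1; rewrite // mul1r.
rewrite PE in Pdis Pmax.
exists b; split; last exact: Pdis.
split; [exact: is_ideal_colon|exact: Pdis|move=> y z Pyz].
have up e : colon K (b * c) `<=` colon K (e * b * c).
  move=> x; rewrite /colon /= => h.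
  have -> : x * (e * b * c) = e * (x * (b * c)) by ring.
  exact: idMl.
have [h|] := pselect (forall t, T t -> ~ colon K (y * b * c) t).
  right; apply: (Pmax (colon K (y * b * c))) => //; first by exists (y * b).
  by rewrite /colon /=; rewrite /colon /= in Pyz;
    have -> : z * (y * b * c) = y * z * (b * c) by ring.
move=> /existsNP [t /not_implyP [Tt /contrapT Kt]]; left.
apply: (Pmax (colon K (t * b * c))) => //.
  exists (t * b) => // s Ts; rewrite /colon /= => h; apply: (Pdis (s * t));
    first exact: TM.
  by rewrite /colon /=; have -> : s * t * (b * c) = s * (t * b * c) by ring.
by rewrite /colon /=; rewrite /colon /= in Kt;
  have -> : y * (t * b * c) = t * (y * b * c) by ring.
Qed.

(** Noetherian induction on [K]. If [R / K] is not zero, it has an associated prime,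
the annihilator of some [e]. Another associated prime, the annihilator of [c],
is the first one if a nonzero multiple of [c] is a multiple of [e] modulo [K];
otherwise it is the annihilator of [c] modulo [K + (e)]. *)
Lemma assoc_finite K : is_ideal K -> exists L : seq (set R),
  (forall P, P \in L -> is_prime P) /\
  forall c, is_prime (colon K c) -> colon K c \in L.
Proof.
move=> idK; apply: contrapT => bad.
have [|//|K1 [[idK1 bad1] _ K1max]] := @noeth_max
  [set K | is_ideal K /\ ~ exists L : seq (set R),
  (forall P, P \in L -> is_prime P) /\
  forall c, is_prime (colon K c) -> colon K c \in L] K; first by move=> ? [].
apply: bad1.
have [K11|K11] := pselect (K1 1).
  exists [::]; split=> // c [_ h _]; case: h.
  by rewrite /colon /=; apply: idMr => //; rewrite -[1]mulr1; apply: idMl.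
have [||b [pP _]] := @assoc_prime [set 1] K1 1 _ idK1.
- by split=> // _ _ -> ->; rewrite mulr1.
- by move=> _ ->; rewrite mulr1.
move: pP; set e := b * 1 => pP.
have Ke : ~ K1 e by move=> h; case: pP => _ + _; apply; rewrite /colon /= mul1r.
have [[L [pL LP]]|h] := pselect (exists L : seq (set R),
  (forall P, P \in L -> is_prime P) /\
  forall c, is_prime (colon (adjoin K1 e) c) -> colon (adjoin K1 e) c \in L); last first.
  case: Ke; apply: (K1max (adjoin K1 e));
    [split=> //|exact: sub_adjoin|exact: adjoin_self].
  exact: is_ideal_adjoin.
exists (colon K1 e :: L); split.
  by move=> P; rewrite inE => /orP[/eqP ->|/pL].
move=> c pc; rewrite inE; apply/orP.
have [[r [[k [s [Kk rcE]]] Krc]]|h] :=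
  pselect (exists r, adjoin K1 e (r * c) /\ ~ K1 (r * c)).
  left; apply/eqP; rewrite predeqE => x.
  have Ps : ~ colon K1 e s.
    by rewrite /colon /= => h; apply: Krc; rewrite rcE; exact: idD.
  have rc : ~ colon K1 c r by [].
  have e1 : K1 (x * (r * c)) <-> K1 (x * (s * e)).
    rewrite rcE mulrDr; split=> h.
      by rewrite -[_ * (s * e)](addKr (x * k)) addrC; apply: idB => //; exact: idMl.
    by apply: idD => //; exact: idMl.
  split=> h.
    have : colon K1 e (x * s).
      rewrite /colon /= -mulrA -e1 mulrCA; exact: idMl.
    by case: pP => _ _ pM /pM [].
  have : colon K1 c (x * r).
    rewrite /colon /= -mulrA e1 mulrCA; exact: idMl.
  by case: pc => _ _ pM /pM [].
right.
have -> : colon K1 c = colon (adjoin K1 e) c.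
  rewrite predeqE => x; split; first by move=> ?; apply: sub_adjoin.
  by move=> hx; apply: contrapT => hn; apply: h; exists x.
apply: LP; congr is_prime : pc.
rewrite predeqE => x; split; first by move=> ?; apply: sub_adjoin.
by move=> hx; apply: contrapT => hn; apply: h; exists x.
Qed.

End Noetherian.

(** Induction on the length of the list. A list with two comparable primes can be
shortened. Otherwise an element [x] that avoids all primes but [P] is corrected,
if it lies in [P], by an element of [I] outside [P] and inside the others. *)
Lemma prime_avoidance (R : comPzRingType) (I : set R) (L : seq (set R)) :
  is_ideal I -> (forall P, P \in L -> is_prime P /\ ~ I `<=` P) ->
  exists2 x, I x & forall P, P \in L -> ~ P x.
Proof.
move=> idI; have [n] := ubnP (size L); elim: n L => // n IH [|P L] szL hL.
  by exists 0; [exact: id0|].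
have [pP IP] := hL P (mem_head _ _).
have hLL Q : Q \in L -> is_prime Q /\ ~ I `<=` Q.
  by move=> QL; apply: hL; rewrite inE QL orbT.
have [[Q QL QP]|hQ] := pselect (exists2 Q, Q \in L & Q `<=` P).
  have [||x Ix xL] := IH (P :: rem Q L).
  - by rewrite /= size_rem // (ltn_predK (_ : 0 < size L)%N) //; case: (L) QL.
  - by move=> S; rewrite inE => /orP[/eqP -> //|/mem_rem /hLL].
  exists x => // S; rewrite inE => /orP[/eqP ->|SL]; first exact/xL/mem_head.
  have [->|SQ] := eqVneq S Q; first by move=> /QP; exact/xL/mem_head.
  apply: xL; rewrite inE; apply/orP; right.
  by move: SL; rewrite (perm_mem (perm_to_rem QL)) inE (negPf SQ).
have [x Ix xL] := IH L szL hLL.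
have [Px|Px] := pselect (P x); last first.
  by exists x => // Q; rewrite inE => /orP[/eqP ->|/xL].
have [y [Iy Py yL]] : exists y, [/\ I y, ~ P y & forall Q, Q \in L -> Q y].
  have [z0 [Iz0 Pz0]] : exists z, I z /\ ~ P z.
    by apply: contrapT => h; apply: IP => z Iz; apply: contrapT => Pz; apply: h; exists z.
  elim: (L) hLL hQ => [|Q M IHM] hM hQ; first by exists z0.
  have [||y [Iy Py yM]] := IHM.
  - by move=> S SM; apply: hM; rewrite inE SM orbT.
  - by move=> [S SM SP]; apply: hQ; exists S => //; rewrite inE SM orbT.
  have [z [Qz Pz]] : exists z, Q z /\ ~ P z.
    apply: contrapT => h; apply: hQ; exists Q; rewrite ?mem_head // => z Qz.
    by apply: contrapT => Pz; apply: h; exists z.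
  exists (y * z); split; [exact: idMr|exact: primeM|].
  move=> S.
  rewrite inE => /orP.
  case=> [/eqP ->|SM].
    by have [pQ _] := hM Q (mem_head _ _); apply: idMl => //; exact: prime_ideal.
  have [|pS _] := hM S; first by rewrite inE SM orbT.
  exact: (idMr (prime_ideal pS) _ (yM _ SM)).
exists (x + y); first exact: idD.
move=> Q; rewrite inE => /orP[/eqP -> h|QL h].
  by apply: Py; rewrite -[y](addKr x) addrC; apply: idB => //; exact: prime_ideal.
have [pQ _] := hLL Q QL; apply: (xL Q QL).
by rewrite -[x](addrK y); apply: idB; [exact: prime_ideal|exact: h|exact: yL].
Qed.

(** * Regular sequences at a prime *)

Section Regular.
Variable R : comPzRingType.
Implicit Types (I J K q P : set R) (x y r : R) (xs : seq R).

(** Multiplication by [x] is injective on the quotient by [K] of the local ring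
at [q]. *)
Definition regular_at q K x := forall r, K (x * r) -> sat q K r.

Fixpoint regseq_at q K xs : Prop :=
  if xs is x :: xs' then [/\ q x,
    regular_at q K x & regseq_at q (adjoin K x) xs'] else True.

Definition depth_ge_at q K (k : nat) := exists2 xs, size xs = k & regseq_at q K xs.

(** In the quotient by [K] of the local ring at [q], no nonzero element is killed by
the maximal ideal. *)
Definition socle_free q K := forall c, (forall a, q a -> sat q K (a * c)) -> sat q K c.

Lemma regular_at_sat q K x r : is_prime q -> regular_at q K x -> sat q K (x * r) ->
  sat q K r.
Proof.
move=> pq nx [u [qu Ku]]; apply: (sat_unit pq qu); apply: nx.
by rewrite mulrCA.
Qed.

Lemma regular_at_socle_free q K x : is_prime q -> q x -> regular_at q K x ->
  socle_free q K.
Proof. by move=> pq qx nx c /(_ x qx); exact: regular_at_sat. Qed.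

Lemma regseq_at_take q K xs k : regseq_at q K xs -> regseq_at q K (take k xs).
Proof.
by elim: xs K k => [|x xs IH] K [|k] //= [qx nx /IH].
Qed.

Lemma regseq_at_rcons q K xs x :
  regseq_at q K xs -> q x -> regular_at q (adjoins K xs) x -> regseq_at q K (rcons xs x).
Proof.
elim: xs K => [|y xs IH] K //= [qy ny ry] qx nx; split=> //; exact: IH.
Qed.

Lemma depth_ge_at_le q K k m : (k <= m)%N -> depth_ge_at q K m -> depth_ge_at q K k.
Proof.
move=> km [xs sz rxs]; exists (take k xs); last exact: regseq_at_take.
by rewrite size_takel ?sz.
Qed.

(** If [x r = k + s y] with [k] in [K], regularity of [y] modulo [K + (x)] makes [s]
a multiple [t x], modulo [K] and up to a unit at [q]; then [x (r - t y)] is in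
[K], and so is [r - t y]. *)
Lemma regular_at_swap q K x y : is_prime q -> is_ideal K ->
  regular_at q K x -> regular_at q (adjoin K x) y -> regular_at q (adjoin K y) x.
Proof.
move=> pq idK nx nxy r [k [s [Kk xrE]]].
have [u [qu [k' [t [Kk' usE]]]]] : sat q (adjoin K x) s.
  apply: nxy; exists (- k), r; split; first exact: idN.
  by rewrite mulrC [r * x]mulrC xrE; ring.
have [v [qv Kv]] : sat q K (u * r - t * y).
  apply: nx; have -> : x * (u * r - t * y) = u * (x * r) - t * x * y by ring.
  have -> : u * (x * r) - t * x * y = u * k + y * (u * s - t * x) by rewrite xrE; ring.
  by rewrite usE addrK; apply: idD => //; exact: idMl.
exists (v * u); split; first exact: primeM.
exists (v * (u * r - t * y)), (v * t); split=> //; ring.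
Qed.

(** The socles modulo [K + (x)] and modulo [K + (y)] correspond to each other: if
[c] is killed by [q] modulo [K + (y)], then [x c = d y] modulo [K], and [d] is
killed by [q] modulo [K + (x)]; regularity of [x] and [y] turns [d] in [K + (x)]
into [c] in [K + (y)]. *)
Lemma socle_free_swap q K x y : is_prime q -> is_ideal K -> q x ->
  regular_at q K x -> regular_at q K y -> socle_free q (adjoin K x) ->
    socle_free q (adjoin K y).
Proof.
move=> pq idK qx nx ny sx c hc.
have [u [qu [k [d [Kk ucE]]]]] := hc x qx.
have [a qa|v [qv [k' [g [Kk' vdE]]]]] := sx d.
  have [v [qv [k' [e [Kk' vaE]]]]] := hc a qa.
  have [w [qw Kw]] : sat q K (v * a * d - u * x * e).
    apply: ny; have -> : y * (v * a * d - u * x * e) =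
      v * a * (k + d * y) - u * x * (k' + e * y) - v * a * k + u * x * k' by ring.
    rewrite -ucE -vaE.
    have -> : v * a * (u * (x * c)) - u * x * (v * (a * c)) - v * a * k + u * x * k' =
      (- (v * a)) * k + u * x * k' by ring.
    by apply: idD => //; exact: idMl.
  exists (w * v); split; first exact: primeM.
  exists (w * (v * a * d - u * x * e)), (w * u * e); split=> //; ring.
have [w [qw Kw]] : sat q K (v * u * c - g * y).
  apply: nx; have -> : x * (v * u * c - g * y) = v * (u * (x * c)) - g * x * y by ring.
  rewrite ucE; have ->
    : v * (k + d * y) - g * x * y = v * k + y * (v * d - g * x) by ring.
  by rewrite vdE addrK; apply: idD => //; exact: idMl.
exists (w * (v * u)); split; first by apply: primeM => //; exact: primeM.
exists (w * (v * u * c - g * y)), (w * g); split=> //; ring.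
Qed.

Hypothesis nR : noetherian R.

(** The zero divisors on the quotient by [K] of the local ring at [q] are covered by
the associated primes below [q]. *)
Lemma regular_atP q K x : is_prime q -> is_ideal K ->
  (forall b, is_prime (colon K b) -> colon K b `<=` q -> ~ colon K b x) ->
  regular_at q K x.
Proof.
move=> pq idK h r Kxr; apply: contrapT => nr.
have [|b [pP Pq]] := assoc_prime nR (c := r) (mult_primeC pq) idK.
  by move=> t qt Ktr; apply: nr; exists t.
apply: (h _ pP) => [a Pa|].
  by apply: contrapT => qa; exact: Pq Pa.
by rewrite /colon /= mulrCA; exact: idMl.
Qed.

Lemma socle_free_assoc q K b : is_prime q -> is_ideal K -> socle_free q K ->
  is_prime (colon K b) -> colon K b `<=` q -> ~ (q `<=` colon K b).
Proof.
move=> pq idK sq pP Pq qP; have [a qa|u [qu Ku]] := sq b.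
  by apply: sub_sat => //; exact: qP.
by apply: qu; exact: Pq.
Qed.

Lemma regular_at_common q K1 K2 : is_prime q -> is_ideal K1 -> is_ideal K2 ->
  socle_free q K1 -> socle_free q K2 ->
    exists z, [/\ q z, regular_at q K1 z & regular_at q K2 z].
Proof.
move=> pq id1 id2 s1 s2.
have [L1 [pL1 hL1]] := assoc_finite nR id1.
have [L2 [pL2 hL2]] := assoc_finite nR id2.
have [P|z qz zL] := @prime_avoidance _ q
    [seq P <- L1 ++ L2 | `[< ~ q `<=` P >]] (prime_ideal pq).
  rewrite mem_filter mem_cat => /andP[/asboolP qP] /orP[/pL1|/pL2] //.
exists z; split=> //; apply: regular_atP => // b pP Pq; apply: zL;
  rewrite mem_filter mem_cat; apply/andP; split.
- by apply/asboolP; exact: socle_free_assoc.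
- by rewrite hL1.
- by apply/asboolP; exact: socle_free_assoc.
- by rewrite hL2 ?orbT.
Qed.

(** Together with [socle_free_swap], this is the reason why all maximal regular
sequences at [q] have the same length. Given a regular sequence beginning with
[y], choose [z] in [q] regular modulo [K + (x)] and modulo [K + (y)]: the
induction hypothesis replaces [y] by [z], and then [z] by [x]. *)
Lemma depth_ge_at_adjoin q k K x : is_prime q -> is_ideal K -> q x -> regular_at q K x ->
  depth_ge_at q K k.+1 -> depth_ge_at q (adjoin K x) k.
Proof.
move=> pq; elim: k K x => [|k IH] K x idK qx nx; first by exists [::].
case=> -[|y ys] //= [sz] [qy ny ry].
have idx := is_ideal_adjoin idK x; have idy := is_ideal_adjoin idK y.
have dy : depth_ge_at q (adjoin K y) k.+1 by exists ys.
have sy : socle_free q (adjoin K y).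
  case: (ys) sz ry => [//|z zs] _ [qz nz _]; exact: regular_at_socle_free qz nz.
have sx := socle_free_swap pq idK qy ny nx sy.
have [z [qz nxz nyz]] := regular_at_common pq idx idy sx sy.
have [ws szw rw] : depth_ge_at q (adjoin (adjoin K z) y) k by rewrite adjoinC; exact: IH.
have dz : depth_ge_at q (adjoin K z) k.+1.
  by exists (y :: ws); rewrite /= ?szw //; split=> //; exact: regular_at_swap.
have [vs szv rv] : depth_ge_at q (adjoin (adjoin K x) z) k.
  by rewrite adjoinC; apply: IH => //; [exact: is_ideal_adjoin|exact: regular_at_swap].
by exists (z :: vs); rewrite /= ?szv.
Qed.

Lemma depth_ge_at_adjoins q K xs m : is_prime q -> is_ideal K -> regseq_at q K xs ->
  depth_ge_at q K (size xs + m) -> depth_ge_at q (adjoins K xs) m.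
Proof.
move=> pq; elim: xs K => [|x xs IH] K idK //= [qx nx rx] d.
by apply: IH => //; [exact: is_ideal_adjoin|exact: depth_ge_at_adjoin].
Qed.

Lemma depth_ge_at_socle_free q K : is_prime q -> depth_ge_at q K 1 -> socle_free q K.
Proof. by move=> pq [[|x []]] //= _ [qx nx _]; exact: regular_at_socle_free qx nx. Qed.

(** * Chains of primes and Krull's height theorem *)

(** A strictly increasing chain of [k + 1] primes that contain [K], with largest
term [P]; for [K = 0] it says that the height of [P] is at least [k]. *)
Fixpoint chain (k : nat) K P : Prop :=
  if k is k'.+1 then is_prime P /\ exists2 Q, Q `<` P & chain k' K Q
  else is_prime P /\ K `<=` P.

Lemma chain_prime k K P : chain k K P -> is_prime P.
Proof. by case: k => [|k] []. Qed.

Lemma chain_top k K P Q : is_prime P -> Q `<=` P -> chain k K Q -> chain k K P.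
Proof.
move=> pP QP; case: k => [|k] /= [pQ].
  by move=> KQ; split=> //; exact: subset_trans QP.
move=> [Q' [Q'Q nQQ'] cQ']; split=> //; exists Q' => //.
by split; [exact: subset_trans QP|move=> PQ'; apply: nQQ'; exact: subset_trans PQ'].
Qed.

Lemma chain_le k m K P : (k <= m)%N -> chain m K P -> chain k K P.
Proof.
elim: m => [|m IH]; first by rewrite leqn0 => /eqP ->.
rewrite leq_eqVlt => /orP[/eqP -> //|km] [pP [Q [QP _] cQ]].
by apply: IH => //; exact: chain_top cQ.
Qed.

(** Take a prime over [K] disjoint from the products of powers of [x] with elements
outside [P]. *)
Lemma prime_below P K x : is_prime P -> is_ideal K ->
  (forall m, ~ sat P K (x ^+ m)) ->
  exists P0, [/\ is_prime P0, K `<=` P0, P0 `<=` P & ~ P0 x].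
Proof.
move=> pP idK nx.
have [||P0 [pP0 KP0 P0T]] := @prime_disjoint _ nR
    [set t | exists m u, ~ P u /\ t = u * x ^+ m] K _ idK.
- split; first by exists 0%N, 1; rewrite expr0 mulr1; split=> //; exact: prime1.
  move=> _ _ [m [u [Pu ->]]] [m' [u' [Pu' ->]]].
  exists (m + m')%N, (u * u'); split; first exact: primeM.
  by rewrite exprD mulrACA.
- by move=> _ [m [u [Pu ->]]] Kux; apply: (nx m); exists u.
exists P0; split=> // [a P0a|].
  apply: contrapT => Pa; apply: (P0T a) => //.
  by exists 0%N, a; rewrite expr0 mulr1.
by apply: P0T; exists 1%N, 1; rewrite expr1 mul1r; split=> //; exact: prime1.
Qed.

(** A regular element avoids some prime below [P] that contains [K], so a chain above
[K + (x)] can be extended downwards. *)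
Lemma chain_regular_at q k K x P : is_prime q -> is_ideal K -> P `<=` q ->
  regular_at q K x ->
  chain k (adjoin K x) P -> chain k.+1 K P.
Proof.
move=> pq idK + nx; elim: k P => [|k IH] P Pq; last first.
  move=> [pP [Q QP cQ]]; split=> //; exists Q => //.
  by apply: IH => //; case: QP => QP _; exact: subset_trans Pq.
move=> [pP KP]; split=> //.
have [m [u [Pu Kux]]|P0 [pP0 KP0 P0P nP0x]] := prime_below (x := x) pP idK.
  have : sat q K u.
    have : sat q K (x ^+ m * u) by rewrite mulrC; exact: sub_sat.
    elim: m {Kux} => [|m IH]; first by rewrite expr0 mul1r.
    by rewrite exprS -mulrA => /(regular_at_sat pq nx).
  move=> [v [qv Kvu]]; apply: (primeM pP (x := v) (y := u)) => //.
    by move=> /Pq.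
  by apply: KP; exact: sub_adjoin.
exists P0; last by split.
by split=> // PP0; apply: nP0x; apply: PP0; apply: KP; exact: adjoin_self.
Qed.

Lemma regseq_at_chain q K xs P : is_prime q -> is_ideal K -> is_prime P -> P `<=` q ->
  regseq_at q K xs -> adjoins K xs `<=` P -> chain (size xs) K P.
Proof.
move=> pq + pP Pq; elim: xs K => [|x xs IH] K idK //= [qx nx rx] KP.
by apply: (chain_regular_at (q := q) (x := x)) => //; apply: IH => //;
  exact: is_ideal_adjoin.
Qed.

Definition min_over J P := forall Q, is_prime Q -> J `<=` Q -> Q `<=` P -> P `<=` Q.

(** The quotient by [J] of the local ring at [P] has finite length, so the images in
it of a descending sequence of ideals stabilize. The length is not defined:
Noetherian induction replaces [J] by [J + (c)], where the annihilator of [c]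
modulo [J] is [P], and compares the sequence with this one simple factor, which
each [L n] meets either in zero or in everything. *)
Lemma descending P J (L : nat -> set R) : is_prime P -> is_ideal J -> min_over J P ->
  (forall n, is_ideal (L n)) -> (forall n m, (n <= m)%N -> L m `<=` L n) ->
  exists n0, forall n m, (n0 <= n <= m)%N -> forall e, L n e ->
  exists u l j, [/\ ~ P u, L m l, J j & u * e = l + j].
Proof.
move=> pP idJ mJ idL decL; apply: contrapT => bad.
have [|//|J1 [[idJ1 mJ1 bad1] _ J1max]] := noeth_max nR (I0 := J)
  (F := [set J | [/\ is_ideal J, min_over J P &
   ~ exists n0, forall n m, (n0 <= n <= m)%N -> forall e, L n e ->
  exists u l j, [/\ ~ P u, L m l, J j & u * e = l + j]]]); first by move=> ? [].
apply: bad1.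
have [[u [Pu Ju]]|J11] := pselect (sat P J1 1).
  exists 0%N => n m _ e Le; exists u, 0, (u * e).
  rewrite mulr1 in Ju.
  by split; rewrite ?add0r //; [exact: id0|exact: idMr].
have [|b []] := assoc_prime nR (c := 1) (mult_primeC pP) idJ1.
  by move=> t Pt Jt; apply: J11; exists t.
move: (b * 1) => c pc cP.
have subc : colon J1 c `<=` P by move=> t ct; apply: contrapT => Pt; exact: cP ct.
have Pc : P `<=` colon J1 c.
  by apply: mJ1 => // x J1x; rewrite /colon /=; exact: idMr.
have Jc : ~ J1 c by move=> h; apply: (prime1 pc); rewrite /colon /= mul1r.
have [n0 hn0] : exists n0, forall n m, (n0 <= n <= m)%N -> forall e, L n e ->
  exists u l j, [/\ ~ P u, L m l, adjoin J1 c j & u * e = l + j].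
  apply: contrapT => h; apply: Jc; apply: (J1max (adjoin J1 c)); last exact: adjoin_self.
    split=> //; first exact: is_ideal_adjoin.
    by move=> Q pQ JQ; apply: mJ1 => //; apply: subset_trans JQ; exact: sub_adjoin.
  exact: sub_adjoin.
(* Either every [L n] meets the simple factor, or none does from some [n1] on. *)
have [h|h] := pselect (forall n, exists2 e, L n e & adjoin J1 c e /\ ~ sat P J1 e).
  exists n0 => n m nm e Le.
  have [u [l [_ [Pu Lml [j [r [Jj ->]]] ueE]]]] := hn0 n m nm e Le.
  have [e' Le' [[j' [r' [Jj' e'E]]] ne']] := h m.
  have Pr' : ~ P r'.
    move=> /Pc; rewrite /colon /= => Jr'c; apply: ne'; apply: sub_sat => //.
    by rewrite e'E; exact: idD.
  exists (r' * u), (r' * l + r * e'), (r' * j - r * j'); split.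
  - exact: primeM.
  - by apply: idD => //; exact: idMl.
  - by apply: idB => //; exact: idMl.
  - by rewrite -mulrA ueE e'E; ring.
move/existsNP: h => [n1 hn1].
exists (maxn n0 n1) => n m /andP[]; rewrite geq_max => /andP[n0n n1n] nm e Le.
have [|u [l [j [Pu Lml Jj ueE]]]] := hn0 n m _ e Le; first by rewrite n0n.
have [v [Pv Jvj]] : sat P J1 j.
  apply: contrapT => nj; apply: hn1; exists j; last by [].
  apply: (decL _ _ n1n).
  have -> : j = u * e - l by rewrite ueE addrAC subrr add0r.
  by apply: idB => //; [exact: idMl|exact: decL Lml].
exists (v * u), (v * l), (v * j); split => //; first exact: primeM.
  exact: idMl.
by rewrite -mulrA ueE mulrDr.
Qed.

(** Otherwise let [I] be maximal among the ideals over [S'] that do not contain [S]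
locally at [P]. If [e x] were outside [I] for some [e] in [S], then [e] would
lie in [I + (e x)], hence in [I], locally at [P], because [1 - r x] is a unit
there. So [S x] lies in [I], and then so does [S]. *)
Lemma nakayama P S S' x : is_prime P -> is_ideal S' -> P x ->
  (forall e, S e -> exists u k t, [/\ ~ P u, S' k, S t & u * e = k + t * x]) ->
  S `<=` sat P S'.
Proof.
move=> pP idS' Px h; apply: contrapT => bad.
have [|//|I [[idI nI] S'I Imax]] := noeth_max nR (I0 := S')
  (F := [set I | is_ideal I /\ ~ S `<=` sat P I]); first by move=> ? [].
have satI : sat P I `<=` I.
  apply: Imax; last exact: sub_sat.
  split; first exact: is_ideal_sat.
  by move=> SI; apply: nI => e /SI [u [Pu]]; exact: sat_unit.
have xSI e : S e -> I (e * x).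
  move=> Se; apply: contrapT => nex.
  suff Ie : I e by apply: nex; exact: idMr.
  have /(_ _ Se) [u [Pu [i [r [Ii uE]]]]] : S `<=` sat P (adjoin I (e * x)).
    apply: contrapT => nSI; apply: nex; apply: (Imax (adjoin I (e * x))).
    - by split=> //; exact: is_ideal_adjoin.
    - exact: sub_adjoin.
    - exact: adjoin_self.
  apply: satI; exists (u - r * x); split.
    move=> Pux; apply: Pu; rewrite -[u](subrK (r * x)).
    by apply: (idD (prime_ideal pP)) => //; apply: (idMl (prime_ideal pP)).
  by rewrite mulrBl uE; have -> : i + r * (e * x) - r * x * e = i by ring.
apply: nI => e /h [u [k [t [Pu S'k St uE]]]].
by exists u; rewrite uE; split=> //; apply: idD => //; [exact: S'I|exact: xSI].
Qed.

(** Krull's principal ideal theorem: [P] is not minimal over [Q0 + (x)]. If it were,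
pick [y] in [Q] outside [Q0] and let [L n] be the ideal generated by [y^n]
modulo [Q0], saturated at [Q]. By [descending], [L n] is contained in
[L (n+1) + (x)] locally at [P] for some [n]; as [x] is outside [Q], only
multiples of [x] by elements of [L n] occur, and [nakayama] gives that [L n] is
contained in [L (n+1)]. Then [y^n] is a multiple of [y^(n+1)] in the local domain
at [Q] modulo [Q0], although [y] is neither zero nor a unit there. *)
Lemma principal_ideal Q0 Q P x : is_prime Q0 -> is_prime Q -> is_prime P ->
  Q0 `<` Q -> Q `<` P -> P x ->
  exists Q', [/\ is_prime Q', Q0 `<=` Q', Q' x & Q' `<` P].
Proof.
move=> pQ0 pQ pP [Q0Q nQQ0] [QP nPQ] Px.
have [Qx|nQx] := pselect (Q x); first by exists Q.
apply: contrapT => h.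
have idQ0 := prime_ideal pQ0.
have mJ : min_over (adjoin Q0 x) P.
  move=> Q' pQ' JQ' Q'P; apply: contrapT => nPQ'; apply: h; exists Q'; split=> //.
    by apply: subset_trans JQ'; exact: sub_adjoin.
  by apply: JQ'; exact: adjoin_self.
have [y [Qy nQ0y]] : exists y, Q y /\ ~ Q0 y.
  apply: contrapT => hy; apply: nQQ0 => y Qy; apply: contrapT => ?.
  by apply: hy; exists y.
pose L n := sat Q (adjoin Q0 (y ^+ n)).
have idL n : is_ideal (L n) by apply: is_ideal_sat => //; exact: is_ideal_adjoin.
have decL n m : (n <= m)%N -> L m `<=` L n.
  move=> nm; apply: sat_mono; apply: adjoin_sub;
    [exact: is_ideal_adjoin|exact: sub_adjoin|].
  by rewrite -(subnK nm) exprD; exact: adjoinM.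
have Q0L n : Q0 `<=` L n.
  by move=> a Qa; apply: sub_sat => //; exact: sub_adjoin.
have [n hn] := descending pP (is_ideal_adjoin idQ0 x) mJ idL decL.
have sub : L n `<=` sat P (L n.+1).
  apply: (nakayama (x := x)) => // e Le.
  have [|u [l [_ [Pu Ll [k [t [Q0k ->]]] uE]]]] := hn n n.+1 _ e Le.
    by rewrite leqnn leqnSn.
  exists u, (l + k), t; split=> //; last by rewrite uE addrA.
    by apply: idD => //; exact: Q0L.
  apply: (sat_unit pQ nQx); rewrite -/(L n).
  have -> : x * t = u * e - l - k by rewrite uE; ring.
  apply: idB => //; last exact: Q0L.
  by apply: idB => //; [exact: idMl|exact: decL Ll].
have [u [Pu [v [Qv [k [r [Q0k wE]]]]]]] : sat P (L n.+1) (y ^+ n).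
  by apply: sub; apply: sub_sat => //; exact: adjoin_self.
have : Q0 (y ^+ n * (v * u - r * y)).
  have -> : y ^+ n * (v * u - r * y) = v * (u * y ^+ n) - r * y ^+ n.+1.
    by rewrite exprS; ring.
  by rewrite wE addrK.
case: (pQ0) => _ _ pM /pM []; first exact: primeX.
move=> /Q0Q Qvu.
have : Q (v * u).
  rewrite -[v * u](subrK (r * y)).
  by apply: (idD (prime_ideal pQ)) => //; apply: (idMl (prime_ideal pQ)).
by apply: primeM => // /QP.
Qed.

(** By [principal_ideal], the terms of a chain ending at [P] can be changed one after
the other, from the top down, so that all but the lowest contain [x];
  the lowest is dropped. *)
Lemma chain_adjoin k K P x : is_ideal K -> P x -> chain k.+1 K P ->
  chain k (adjoin K x) P.
Proof.
move=> idK; elim: k P => [|k IH] P Px [pP [Q QP cQ]].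
  have [pQ KQ] := cQ; split=> //; apply: adjoin_sub => //; first exact: prime_ideal.
  by case: QP => QP _; exact: subset_trans KQ QP.
case: cQ => pQ [Q0 Q0Q cQ0].
have [Q0x|nQ0x] := pselect (Q0 x).
  split=> //; exists Q => //; apply: IH; first by case: Q0Q => + _; exact.
  by split=> //; exists Q0.
have [Q' [pQ' Q0Q' Q'x Q'P]] := principal_ideal (chain_prime cQ0) pQ pP Q0Q QP Px.
split=> //; exists Q' => //; apply: IH => //; split=> //; exists Q0 => //.
by split=> // /(_ _ Q'x).
Qed.

(** Krull's height theorem, for chains above [K]. *)
Lemma chain_adjoins k K P xs : is_ideal K -> (forall x, x \in xs -> P x) ->
  chain (size xs + k) K P -> chain k (adjoins K xs) P.
Proof.
elim: xs K => [|x xs IH] K //= idK xsP c.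
apply: IH; [exact: is_ideal_adjoin|by move=> y yxs; apply: xsP; rewrite inE yxs orbT|].
by apply: chain_adjoin => //; apply: xsP; rewrite mem_head.
Qed.

End Regular.

(** * Purity *)

Section QuotientModule.
Variables (A : comPzRingType) (V : lmodType A).

Definition is_submod (U : set V) :=
  [/\ U 0, forall x y, U x -> U y -> U (x + y) & forall a x, U x -> U (a *: x)].

Record submod := Submod { submod_set :> V -> Prop; submodP : is_submod submod_set }.

Variable U : submod.

Definition submod_pred : {pred V} := [pred v | `[< U v >]].

Lemma submod_zmod_closed : zmod_closed submod_pred.
Proof.
case: (submodP U) => U0 UD UZ; split=> [|x y /asboolP Ux /asboolP Uy];
  apply/asboolP => //.
by apply: UD => //; rewrite -scaleN1r; exact: UZ.
Qed.

HB.instance Definition _ := GRing.isZmodClosed.Build V submod_pred submod_zmod_closed.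

Definition quotmod : Type := Quotient.quot submod_pred.

HB.instance Definition _ := GRing.Zmodule.on quotmod.

Definition quotmod_pi (v : V) : quotmod := \pi_(Quotient.quot submod_pred) v.

Lemma quotmod_piE u v : quotmod_pi u = quotmod_pi v <-> U (u - v).
Proof.
rewrite /quotmod_pi; split=> [/eqP|h].
  by rewrite -Quotient.idealrBE => /asboolP.
by apply/eqP; rewrite -Quotient.idealrBE; apply/asboolP.
Qed.

Lemma quotmod_piD u v : quotmod_pi (u + v) = quotmod_pi u + quotmod_pi v.
Proof. exact: (raddfD (\pi_(Quotient.quot submod_pred))). Qed.

Lemma quotmod_pi0 : quotmod_pi 0 = 0.
Proof. exact: (raddf0 (\pi_(Quotient.quot submod_pred))). Qed.

Lemma quotmodK (x : quotmod) : quotmod_pi (repr (x : Quotient.quot submod_pred)) = x.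
Proof. exact: reprK. Qed.

Definition quotmod_scale (a : A) (x : quotmod) : quotmod :=
  quotmod_pi (a *: repr (x : Quotient.quot submod_pred)).

Lemma quotmod_scaleE a v : quotmod_scale a (quotmod_pi v) = quotmod_pi (a *: v).
Proof.
apply/quotmod_piE; rewrite -scalerBr; case: (submodP U) => _ _; apply.
by apply/quotmod_piE; rewrite quotmodK.
Qed.

Lemma quotmod_scaleA a b x :
  quotmod_scale a (quotmod_scale b x) = quotmod_scale (a * b) x.
Proof. by rewrite -(quotmodK x) !quotmod_scaleE scalerA. Qed.

Lemma quotmod_scale1 : left_id 1 quotmod_scale.
Proof. by move=> x; rewrite -(quotmodK x) !quotmod_scaleE scale1r. Qed.

Lemma quotmod_scaleDr : right_distributive quotmod_scale +%R.
Proof.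
move=> a x y; rewrite -(quotmodK x) -(quotmodK y).
by rewrite -quotmod_piD !quotmod_scaleE -quotmod_piD scalerDr.
Qed.

Lemma quotmod_scaleDl x : {morph quotmod_scale^~ x : a b / a + b}.
Proof.
by move=> a b; rewrite -(quotmodK x) !quotmod_scaleE -quotmod_piD scalerDl.
Qed.

HB.instance Definition _ := GRing.Zmodule_isLmodule.Build A quotmod
  quotmod_scaleA quotmod_scale1 quotmod_scaleDr quotmod_scaleDl.

Lemma quotmod_piZ a v : quotmod_pi (a *: v) = a *: quotmod_pi v.
Proof. by rewrite -quotmod_scaleE. Qed.

End QuotientModule.

Section Purity.
Variables (A B : comPzRingType) (f : {rmorphism A -> B}).
Hypothesis f_pure : pure f.

(** An element of the extension to [B] of an ideal that kills [e] also kills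
[1 (x) e]. *)
Lemma tens_adjoins (W : lmodType A) (e : W) (xs : seq A) (b : B) :
  (forall x, x \in xs -> x *: e = 0) -> adjoins [set 0] (map f xs) b ->
  tens (b : restrict f) e = 0.
Proof.
elim/last_ind: xs b => [|xs x IH] b he; first by move=> /= ->; exact: tens0l.
rewrite map_rcons adjoins_rcons => -[k [r [kxs ->]]].
rewrite tensDl IH //; last by move=> y yxs; apply: he; rewrite mem_rcons inE yxs orbT.
have -> : tens (r * f x : restrict f) e = tens ((x *: (r : restrict f)) : restrict f) e.
  by congr tens; rewrite mulrC.
rewrite tensZ he ?mem_rcons ?mem_head // add0r.
apply: (addrI (tens (r : restrict f) (0 : W))); by rewrite -tensDr !addr0.
Qed.

(** [H] is the annihilator in [B] of [1 (x) v] in [B (x)_A V/U]. Purity says that it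
contracts to the annihilator of [v] modulo [U]. The last property serves to
exhibit elements of [H]: when [v = c e] modulo [U] and [e] is killed by [xs], an
element [b] with [b c] in the ideal of [B] generated by [xs] is in [H]. *)
Lemma pure_annihilator (V : lmodType A) (U : submod V) (v : V) :
  exists H : set B, [/\ is_ideal H, forall a, H (f a) <-> U (a *: v) &
    forall (c : A) (e : V) (xs : seq A) (b : B), U (v - c *: e) ->
      (forall x, x \in xs -> U (x *: e)) ->
      adjoins [set 0] (map f xs) (b * f c) -> H b].
Proof.
pose w : quotmod U := quotmod_pi U v.
have tens0r (b : restrict f) : tens b (0 : quotmod U) = 0.
  by apply: (addrI (tens b 0)); rewrite -tensDr !addr0.
have tf a : tens (f a : restrict f) w = tens (1 : restrict f) (a *: w).
  rewrite -tensZ; congr tens; symmetry; exact: mulr1.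
exists [set b | tens (b : restrict f) w = 0]; split.
- split=> /=; first exact: tens0l.
    by move=> x y hx hy; rewrite tensDl hx hy addr0.
  move=> a x hx.
  have [|||g [gD gE]] :=
    @tensor_lift A (restrict f) (quotmod U) (tensor (restrict f) (quotmod U))
      (fun m n => tens (a * (m : B) : restrict f) n).
  - by move=> m m' n; rewrite -tensDl; congr tens; exact: mulrDr.
  - by move=> m n n'; rewrite -tensDr.
  - move=> b m n; rewrite -tensZ; congr tens; exact: mulrCA.
  rewrite -(gE x) hx; apply: (addrI (g 0)); by rewrite -gD !addr0.
- move=> a /=; rewrite tf; split=> [h|h].
    have : a *: w = 0 by apply: f_pure; rewrite h tens0r.
    by rewrite -quotmod_piZ -quotmod_pi0 => /quotmod_piE; rewrite subr0.
  have -> : a *: w = 0.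
    by rewrite -quotmod_piZ -quotmod_pi0; apply/quotmod_piE; rewrite subr0.
  exact: tens0r.
- move=> c e xs b /quotmod_piE; rewrite quotmod_piZ -/w => -> he hb /=.
  rewrite -tensZ.
  have -> : tens (c *: (b : restrict f) : restrict f) (quotmod_pi U e) =
    tens (b * f c : restrict f) (quotmod_pi U e).
    by congr tens; exact: mulrC.
  apply: tens_adjoins hb => x /he h; rewrite -quotmod_piZ -quotmod_pi0.
  by apply/quotmod_piE; rewrite subr0.
Qed.

(** [pure_annihilator] with [V = A] and [U] the ideal itself. *)
Lemma pure_contract (xs : seq A) (a : A) :
  adjoins [set 0] (map f xs) (f a) -> adjoins [set 0] xs a.
Proof.
move=> h; have idJ := is_ideal_adjoins xs (is_ideal0 A).
have subJ : @is_submod A A^o (adjoins [set 0] xs).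
  split; [exact: id0|exact: (idD idJ)|].
  by move=> b x; exact: (idMl idJ).
have [H [_ HE Hidl]] := @pure_annihilator A^o (Submod subJ) (a : A^o).
have : H (f 1).
  rewrite rmorph1; apply: (Hidl a (1 : A^o) xs); rewrite ?mul1r //.
    rewrite /= [_ *: _]mulr1 subrr; exact: id0.
  by move=> x xxs; rewrite /= [_ *: _]mulr1; apply: adjoins_mem => //; exact: is_ideal0.
by move=> /HE /=; rewrite scale1r.
Qed.

(** An ideal [I] is generated by any finite part of it whose extension to [B] is
maximal among extensions of finite parts of [I]. *)
Lemma pure_noetherian : noetherian B -> noetherian A.
Proof.
move=> nB I idI.
have [||_ [[xs xsI ->] _ xsmax]] := noeth_max nB (I0 := adjoins [set 0] (map f [::]))
  (F := [set K | exists2 xs, (forall x, x \in xs ->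
    I x) & K = adjoins [set 0] (map f xs)]).
- by move=> _ [xs _ ->]; apply: is_ideal_adjoins; exact: is_ideal0.
- by exists [::].
exists xs; rewrite ideal_genE eqEsubset; split; last first.
  by apply: adjoins_sub => // _ ->; exact: id0.
move=> a Ia; apply: pure_contract; apply: (xsmax (adjoins [set 0] (map f (rcons xs a)))).
- exists (rcons xs a) => // x; rewrite mem_rcons inE => /orP[/eqP -> //|]; exact: xsI.
- by rewrite map_rcons adjoins_rcons; exact: sub_adjoin.
- rewrite map_rcons adjoins_rcons; apply: adjoin_self; apply: is_ideal_adjoins;
  exact: is_ideal0.
Qed.

End Purity.

(** * Fibers *)

Section ResidueFractions.
Variables (R : comPzRingType) (p : spec R).

Lemma fracB a b (s t : denom p) :
  frac a s - frac b t = frac (a * sval t - b * sval s) (denomM s t).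
Proof. by rewrite fracN fracD mulNr. Qed.

Lemma loc_maxE a (s : denom p) : loc_max (frac a s) <-> p a.
Proof.
have pp := specP p; split=> [[b [t [pb /fracE [u uE]]]]|pa]; last by exists a, s.
have : p (sval u * (a * sval t)).
  by rewrite uE; apply: (idMl (prime_ideal pp)); exact: (idMr (prime_ideal pp) _ _).
by case: pp => _ _ pM /pM [/denomP //|/pM [//|/denomP]].
Qed.

Definition res_frac (a : R) (s : denom p) : residue_field p :=
  \pi_{ideal_quot @loc_maxb R p} (frac a s).

Lemma res_fracP (x : residue_field p) : exists a s, x = res_frac a s.
Proof.
have [a [s e]] := fracP (repr x); exists a, s.
by rewrite /res_frac -e reprK.
Qed.

Lemma res_frac_eq a b (s t : denom p) :
  res_frac a s = res_frac b t <-> p (a * sval t - b * sval s).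
Proof.
rewrite -(loc_maxE _ (denomM s t)) -fracB /res_frac; split=> [/eqP|h].
  by rewrite -Quotient.idealrBE => /asboolP.
by apply/eqP; rewrite -Quotient.idealrBE; apply/asboolP.
Qed.

Lemma res_fracD a b (s t : denom p) :
  res_frac a s + res_frac b t = res_frac (a * sval t + b * sval s) (denomM s t).
Proof. by rewrite /res_frac -rmorphD fracD. Qed.

Lemma res_fracM a b (s t : denom p) :
  res_frac a s * res_frac b t = res_frac (a * b) (denomM s t).
Proof. by rewrite /res_frac -rmorphM fracM. Qed.

Lemma to_residueE a : to_residue p a = res_frac a (denom1 p).
Proof. by []. Qed.

Lemma res_frac_eq0 a (s : denom p) : res_frac a s = 0 <-> p a.
Proof.
have -> : 0 = res_frac 0 (denom1 p) by rewrite -to_residueE rmorph0.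
by rewrite res_frac_eq mulr1 mul0r subr0.
Qed.

End ResidueFractions.

Section Fibers.
Variables (A B : comPzRingType) (f : {rmorphism A -> B}) (p : spec A).
Local Notation fiber := (fiber_ring f p).

Definition ftens (b : B) (x : residue_field p) : fiber :=
  @tens A (restrict f) (restrict (@to_residue A p)) b x.

Lemma ftensZ b a x : ftens (b * f a) x = ftens b (to_residue p a * x).
Proof. by rewrite mulrC; exact: (@tensZ A (restrict f) (restrict (@to_residue A p))). Qed.

Lemma ftens_denom b (s t : denom p) :
  ftens (b * f (sval s)) (res_frac 1 (denomM s t)) = ftens b (res_frac 1 t).
Proof.
rewrite ftensZ to_residueE res_fracM; congr ftens; apply/res_frac_eq => /=.
rewrite !mulr1 !mul1r subrr; exact: (id0 (prime_ideal (specP p))).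
Qed.

Lemma ftensD b c (s t : denom p) :
  ftens b (res_frac 1 s) + ftens c (res_frac 1 t) =
  ftens (b * f (sval t) + c * f (sval s)) (res_frac 1 (denomM s t)).
Proof.
rewrite /ftens [RHS]tensDl -[RHS]/(ftens _ _ + ftens _ _) (ftens_denom c).
rewrite -[LHS]/(ftens _ _ + ftens _ _) -(ftens_denom b t s); congr (ftens _ _ + _).
apply/res_frac_eq => /=; rewrite !mul1r mulrC subrr.
exact: (id0 (prime_ideal (specP p))).
Qed.

(** Denominators can be cleared, since elements of [A] move across the tensor
product. *)
Lemma ftensP (z : fiber) : exists b s, z = ftens b (res_frac 1 s).
Proof.
elim/tensor_ind: z => [|b x|z w [b [s ->]] [c [t ->]]].
- by exists 0, (denom1 p); symmetry; exact: tens0l.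
- have [a [s ->]] := res_fracP x; exists (b * f a), s.
  rewrite ftensZ to_residueE res_fracM; congr ftens; apply/res_frac_eq => /=.
  rewrite mulr1 mul1r subrr; exact: (id0 (prime_ideal (specP p))).
- exists (b * f (sval t) + c * f (sval s)), (denomM s t).
  by rewrite -ftensD.
Qed.

Variables (q : spec B).
Hypothesis over : forall a, q (f a) <-> p a.

Lemma denom_map_subproof (s : denom p) : `[< ~ q (f (sval s)) >].
Proof. by apply/asboolP => /over /denomP. Qed.

Definition denom_map (s : denom p) : denom q :=
  exist (fun b => `[< ~ q b >]) (f (sval s)) (denom_map_subproof s).

(** The canonical map from the fiber to the residue field of [q] sends [b (x) 1/s] to
[b/s], which vanishes exactly when [b] is in [q]. *)
Lemma ftens_eq b c (s t : denom p) :
  ftens b (res_frac 1 s) = ftens c (res_frac 1 t) -> q b -> q c.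
Proof.
have /choice [phi phiP] : forall x : residue_field p, exists y : residue_field q,
    forall a s, x = res_frac a s -> y = res_frac (f a) (denom_map s).
  move=> x; have [a0 [s0 ->]] := res_fracP x.
  exists (res_frac (f a0) (denom_map s0)) => a u /res_frac_eq e.
  by apply/res_frac_eq => /=; rewrite -!rmorphM -rmorphB; apply/over.
have phiE a u : phi (res_frac a u) = res_frac (f a) (denom_map u) by exact: phiP.
have [|||g [_ gE]] := @tensor_lift A (restrict f) (restrict (@to_residue A p))
    (residue_field q) (fun b x => to_residue q b * phi x).
- by move=> m m' n; rewrite rmorphD mulrDl.
- move=> m n n'; rewrite -mulrDr; congr (_ * _).
  have [a [u ->]] := res_fracP n; have [a' [u' ->]] := res_fracP n'.
  rewrite [_ + _]res_fracD !phiE res_fracD rmorphD !rmorphM.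
  by apply/res_frac_eq; rewrite /= rmorphM subrr; exact: (id0 (prime_ideal (specP q))).
- move=> a m n; have [a' [u ->]] := res_fracP n.
  rewrite -[a *: m]/(f a * m) -[a *: _]/(to_residue p a * res_frac a' u).
  rewrite [f a * m]mulrC [to_residue q _]rmorphM -mulrA; congr (_ * _).
  rewrite !to_residueE res_fracM !phiE res_fracM rmorphM.
  by apply/res_frac_eq; rewrite /= rmorphM rmorph1 subrr;
    exact: (id0 (prime_ideal (specP q))).
move=> e; have := congr1 g e.
rewrite /ftens !gE !phiE !to_residueE !res_fracM rmorph1 !mulr1 => {}e qb.
by apply/(res_frac_eq0 c (denomM (denom1 q) (denom_map t))); rewrite -e;
  apply/res_frac_eq0.
Qed.

Definition fiber_prime : set fiber :=
  [set z | exists b s, z = ftens b (res_frac 1 s) /\ q b].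

Lemma fiber_primeE b s : fiber_prime (ftens b (res_frac 1 s)) <-> q b.
Proof. by split=> [[c [t [e qc]]]|qb]; [exact: ftens_eq (esym e) qc|exists b, s]. Qed.

Lemma ftens_mul b c (s t : denom p) :
  ftens b (res_frac 1 s) * ftens c (res_frac 1 t) =
  ftens (b * c) (res_frac 1 (denomM s t)).
Proof.
by rewrite [LHS]tensM res_fracM mulr1.
Qed.

Lemma is_prime_fiber_prime : is_prime fiber_prime.
Proof.
have pq := specP q; have idq := prime_ideal pq.
split; first split.
- by exists 0, (denom1 p); split; [symmetry; exact: tens0l|exact: id0].
- move=> _ _ [b [s [-> qb]]] [c [t [-> qc]]].
  exists (b * f (sval t) + c * f (sval s)), (denomM s t); rewrite ftensD; split=> //.
  by apply: idD => //; exact: idMr.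
- move=> z _ [b [s [-> qb]]]; have [c [t ->]] := ftensP z.
  rewrite ftens_mul; apply/fiber_primeE.
  exact: (idMl idq _ qb).
- have -> : 1 = ftens 1 (res_frac 1 (denom1 p)).
    by rewrite -to_residueE rmorph1.
  by move/fiber_primeE; exact: prime1.
- move=> z w; have [b [s ->]] := ftensP z; have [c [t ->]] := ftensP w.
  by rewrite ftens_mul !fiber_primeE; case: pq => _ _; apply.
Qed.

End Fibers.

(** Strictly comparable primes over [p] would induce a chain of length one in the
fiber. *)
Lemma fiber_incomparable (A B : comPzRingType) (f : {rmorphism A -> B}) (p : spec A)
    (P Q : set B) : zero_dimensional (fiber_ring f p) ->
  is_prime P -> is_prime Q -> (forall a, P (f a) <-> p a) ->
    (forall a, Q (f a) <-> p a) ->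
  P `<=` Q -> Q `<=` P.
Proof.
move=> dim0 pP pQ overP overQ PQ b Qb; apply: contrapT => nPb.
have : ((1%:Z)%:E <= krull_dim (fiber_ring f p))%E.
  apply/sup_nat_ge; exists 1%N => //=.
  exists (fun i => if i == 0%N then @fiber_prime A B f p (Spec pP)
                 else @fiber_prime A B f p (Spec pQ)); split.
    by move=> i _; case: eqP => _; exact: is_prime_fiber_prime.
  move=> [|//] _ /=; split.
    by move=> _ [c [s [-> Pc]]]; exists c, s; split=> //; exact: PQ.
  move=> /(_ (ftens f b (res_frac 1 (denom1 p)))) h; apply: nPb.
  by apply/(@fiber_primeE A B f p (Spec pP) overP b (denom1 p)); apply: h;
    apply/fiber_primeE.
by rewrite dim0 lee_fin.
Qed.

(** * Localizations read off the ring *)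

Section WeaklyRegular.
Variable S : comPzRingType.

(** The recursion on the base ideal that underlies [regular_seq]; properness of the
ideal generated by the sequence is kept apart. *)
Fixpoint weakly_regular (K : set S) (xs : seq S) : Prop :=
  if xs is x :: xs' then (forall r, K (x * r) ->
    K r) /\ weakly_regular (adjoin K x) xs' else True.

Lemma weakly_regularP K xs : weakly_regular K xs <->
  forall i, (i < size xs)%N -> forall r,
    adjoins K (take i xs) (xs`_i * r) -> adjoins K (take i xs) r.
Proof.
elim: xs K => [|x xs IH] K //=; split.
  by move=> [hx /IH h] [|i] //=; rewrite ltnS; exact: h.
by move=> h; split; [exact: (h 0%N)|apply/IH => i ixs; exact: (h i.+1)].
Qed.

Lemma regular_seqE xs : regular_seq xs <->
  weakly_regular [set 0] xs /\ ~ adjoins [set 0] xs 1.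
Proof.
rewrite /regular_seq ideal_genE weakly_regularP; split=> -[h ?]; split=> // i ixs r.
  by rewrite -!ideal_genE; exact: h.
by rewrite !ideal_genE; exact: h.
Qed.

End WeaklyRegular.

Section Localized.
Variables (R : comPzRingType) (q : spec R).
Let pq : is_prime q := specP q.
Let L : comPzRingType := localization q.

(** [K'] is the extension of [K] to the localization. *)
Definition loc_corr (K : set R) (K' : set L) :=
  forall a (s : denom q), K' (frac a s) <-> sat q K a.

Lemma loc_corr0 : loc_corr [set 0] [set 0].
Proof.
move=> a s; rewrite /= -(frac0 q); split=> [/fracE [u /=]|[u [qu /= ua]]].
  rewrite mulr1 mul0r mulr0 => ua; exists (sval u); split=> //; exact: denomP.
apply/fracE; exists (exist (fun u => `[< ~ q u >]) u (asboolT qu)) => /=.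
by rewrite mulr1 ua mul0r mulr0.
Qed.

Lemma loc_corr_adjoin K K' a (s : denom q) : is_ideal K -> is_ideal K' ->
  loc_corr K K' -> loc_corr (adjoin K a) (adjoin K' (frac a s)).
Proof.
move=> idK idK' KK' b t.
have idS := is_ideal_sat pq (is_ideal_adjoin idK a).
split=> [[k' [r' [Kk' e]]]|[u [qu [k [r [Kk ubE]]]]]].
  have [k [v kE]] := fracP k'; have [r [w rE]] := fracP r'.
  move: Kk'; rewrite kE => /KK' satk.
  move: e; rewrite kE rE fracM fracD => /fracE [u /= uE].
  apply: (sat_unit pq (u := sval u * (sval v * (sval w * sval s)))).
    do ?[apply: (primeM pq)]; exact: denomP.
  have -> : sval u * (sval v * (sval w * sval s)) * b =
    sval u * (b * (sval v * (sval w * sval s))) by ring.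
  rewrite uE; apply: (idMl idS); apply: (idMr idS); apply: (idD idS).
    apply: (idMr idS); apply: sat_mono satk; exact: sub_adjoin.
  apply: (idMr idS); apply: (sub_sat pq); exact: adjoinM.
pose u' : denom q := exist (fun u => `[< ~ q u >]) u (asboolT qu).
exists (frac k (denomM u' t)), (frac (r * sval s) (denomM u' t)); split.
  by apply/KK'; exact: sub_sat.
rewrite fracM fracD; apply: frac_eq => /=.
transitivity (u * b * (u * sval t * (sval t * sval s))); first by ring.
by rewrite ubE; ring.
Qed.

(** Denominators are units, so the terms of a sequence may be replaced by their
numerators. *)
Lemma weakly_regular_regseq_at K K' xs : is_ideal K -> is_ideal K' -> loc_corr K K' ->
  (forall x, x \in xs -> loc_max x) -> weakly_regular K' xs ->
  exists2 ys, size ys = size xs & regseq_at q K ys.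
Proof.
elim: xs K K' => [|x xs IH] K K' idK idK' KK' xm /=; first by exists [::].
move=> [nx wx]; have [a [s [qa xE]]] := xm x (mem_head _ _).
have [||||ys <- rys] := IH (adjoin K a) (adjoin K' x) _ _ _ _ wx.
- exact: is_ideal_adjoin.
- exact: is_ideal_adjoin.
- by rewrite xE; exact: loc_corr_adjoin.
- by move=> y yxs; apply: xm; rewrite inE yxs orbT.
exists (a :: ys) => //=; split=> // r Kar.
apply/(KK' _ (denom1 q)); apply: nx; rewrite xE fracM; apply/KK'; exact: sub_sat.
Qed.

Lemma regseq_at_weakly_regular K K' xs : is_ideal K -> is_ideal K' -> loc_corr K K' ->
  regseq_at q K xs -> weakly_regular K' (map (@to_loc R q) xs).
Proof.
elim: xs K K' => [//|x xs IH] K K' idK idK' KK' /= [qx nx rx]; split; last first.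
  apply: IH rx; [exact: is_ideal_adjoin|exact: is_ideal_adjoin|exact: loc_corr_adjoin].
move=> r; have [b [s ->]] := fracP r.
by rewrite fracM => /KK' h; apply/KK'; exact: regular_at_sat h.
Qed.

Lemma depth_ge_at_of_depth k : ((k%:Z)%:E <= depth (@loc_max R q))%E ->
  depth_ge_at q [set 0] k.
Proof.
move=> /sup_nat_ge [m [xs [szxs xm /regular_seqE [wxs _]]] km].
apply: depth_ge_at_le km _; rewrite -szxs.
have [ys szys rys] :=
  weakly_regular_regseq_at (is_ideal0 R) (is_ideal0 L) loc_corr0 xm wxs.
by exists ys.
Qed.

Lemma is_ideal_loc_max : is_ideal (@loc_max R q).
Proof.
have [/asboolP m0 _ mD] := loc_max_idealr q.
split=> // [x y mx my|a x mx].
  by rewrite -[x]mul1r; apply/asboolP; apply: mD; exact/asboolP.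
by rewrite -[a * x]addr0; apply/asboolP; apply: mD; exact/asboolP.
Qed.

Lemma depth_of_depth_ge_at k : depth_ge_at q [set 0] k ->
  ((k%:Z)%:E <= depth (@loc_max R q))%E.
Proof.
move=> [xs szxs rxs]; apply/sup_nat_ge; exists k => //=.
have qxs x : x \in xs -> q x.
  move: rxs; elim: (xs) [set 0] x => [//|y ys IH] K x /= [qy _ ry].
  rewrite inE => /orP[/eqP -> //|yx]; exact: (IH (adjoin K y)).
exists (map (@to_loc R q) xs); split; first by rewrite size_map.
  by move=> _ /mapP [x /qxs qx ->]; exists x, (denom1 q).
apply/regular_seqE; split.
  exact: regseq_at_weakly_regular (is_ideal0 R) (is_ideal0 L) loc_corr0 rxs.
move=> h; have : @loc_max R q 1.
  apply: adjoins_sub h; first exact: is_ideal_loc_max.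
    move=> _ ->; exact: (id0 is_ideal_loc_max).
  by move=> _ /mapP [x /qxs qx ->]; exists x, (denom1 q).
rewrite -(frac1 q) => /loc_maxE; exact: prime1.
Qed.

Lemma chain_fun k (K P : set R) : chain k K P -> exists c : nat -> set R,
  [/\ c k = P, forall i, (i <= k)%N -> is_prime (c i) &
   forall i, (i < k)%N -> c i `<` c i.+1].
Proof.
elim: k P => [|k IH] P /= [pP]; first by exists (fun=> P).
move=> [Q QP /IH [c [cQ pc cc]]].
exists (fun i => if (i <= k)%N then c i else P); rewrite ltnn; split=> //.
  by move=> i _; case: ifP => // /pc.
move=> i; rewrite ltnS => ik; rewrite ik.
by case: ltngtP ik => // [/cc //|-> _]; rewrite cQ.
Qed.

Definition loc_ext (P : set R) : set L := [set x | exists a s, x = frac a s /\ P a].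

Lemma loc_extE (P : set R) a (s : denom q) : is_prime P -> P `<=` q ->
  loc_ext P (frac a s) <-> P a.
Proof.
move=> pP Pq; split=> [[b [t [/fracE [u uE] Pb]]]|Pa]; last by exists a, s.
have nd (v : denom q) : ~ P (sval v) by move=> /Pq /denomP.
have : P (sval u * (a * sval t)).
  by rewrite uE; apply: (idMl (prime_ideal pP)); apply: (idMr (prime_ideal pP)).
by case: (pP) => _ _ pM /pM [/nd //|/pM [//|/nd]].
Qed.

Lemma loc_ext_prime (P : set R) : is_prime P -> P `<=` q -> is_prime (loc_ext P).
Proof.
move=> pP Pq; have idP := prime_ideal pP; split; first split.
- by exists 0, (denom1 q); split=> //; exact: id0.
- move=> _ _ [a [s [-> Pa]]] [b [t [-> Pb]]].
  rewrite fracD; apply/loc_extE => //.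
  by apply: (idD idP); exact: (idMr idP).
- move=> x _ [a [s [-> Pa]]]; have [b [t ->]] := fracP x.
  by rewrite fracM; apply/loc_extE => //; exact: (idMl idP).
- rewrite -(frac1 q) => /loc_extE h; apply: (prime1 pP); exact: h.
- move=> x y; have [a [s ->]] := fracP x; have [b [t ->]] := fracP y.
  by rewrite fracM !loc_extE //; case: pP => _ _; apply.
Qed.

Lemma dim_of_chain k : chain k [set 0] q -> ((k%:Z)%:E <= krull_dim L)%E.
Proof.
move=> /chain_fun [c [cq pc cc]]; apply/sup_nat_ge; exists k => //=.
have cle i : (i <= k)%N -> c i `<=` q.
  suff h j : (j <= k)%N -> (i <= j)%N -> c i `<=` c j by rewrite -cq; exact: h.
  elim: j => [|j IH]; first by rewrite leqn0 => _ /eqP ->.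
  move=> jk; rewrite leq_eqVlt => /orP[/eqP -> //|ij].
  by apply: subset_trans (IH (ltnW jk) ij) _; case: (cc j jk).
exists (fun i => loc_ext (c i)); split=> [i ik|i ik].
  by apply: loc_ext_prime; [exact: pc|exact: cle].
have [h nh] := cc i ik; split.
  by move=> _ [a [s [-> ca]]]; exists a, s; split=> //; exact: h.
move=> H; apply: nh => a ca.
have /H : loc_ext (c i.+1) (frac a (denom1 q)) by exists a, (denom1 q).
by move=> /loc_extE; apply; [exact: pc (ltnW ik)|exact: cle (ltnW ik)].
Qed.

Definition loc_contr (Q : set L) : set R := [set a | Q (to_loc q a)].

Lemma loc_contrE (Q : set L) a (s : denom q) : is_prime Q ->
  Q (frac a s) <-> loc_contr Q a.
Proof.
move=> /prime_ideal idQ; rewrite /loc_contr /=.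
have -> : to_loc q a = to_loc q (sval s) * frac a s.
  by rewrite /to_loc fracM; apply: frac_eq => /=; ring.
split=> [|h]; first exact: idMl.
have -> : frac a s = frac 1 s * (to_loc q (sval s) * frac a s).
  by rewrite /to_loc !fracM; apply: frac_eq => /=; ring.
exact: idMl.
Qed.

Lemma chain_of_dim k : ((k%:Z)%:E <= krull_dim L)%E -> chain k [set 0] q.
Proof.
move=> /sup_nat_ge [m [c [pc cc]] km]; apply: chain_le km _.
have h i : (i <= m)%N -> chain i [set 0] (loc_contr (c i)).
  elim: i => [|i IH] im.
    have pp := prime_preimage (@to_loc R q) (pc _ im).
    split=> // _ ->; exact: (id0 (prime_ideal pp)).
  split; first exact: (prime_preimage (@to_loc R q) (pc _ im)).
  exists (loc_contr (c i)); last exact: IH (ltnW im).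
  have [ci nci] := cc i im; split; first by move=> a; exact: ci.
  move=> sub; apply: nci => x; have [a [s ->]] := fracP x.
  move=> h; apply/(loc_contrE a s (pc i (ltnW im))); apply: sub.
  exact/(loc_contrE a s (pc _ im)).
apply: (chain_top pq) (h m (leqnn m)) => a ca; apply: contrapT => qa.
apply: (prime1 (pc m (leqnn m))); rewrite -(frac1 q).
pose s : denom q := exist (fun u => `[< ~ q u >]) a (asboolT qa).
have -> : frac 1 (denom1 q) = frac a s by apply: frac_eq => /=; rewrite mulr1 mul1r.
by apply/loc_contrE => //; exact: pc.
Qed.

(** Serre's condition at [q], free of extended integers and of the localization. *)
Lemma serre_local n :
  (forall k, (k <= n)%N -> chain k [set 0] q -> depth_ge_at q [set 0] k) <->
  (Order.min (n%:Z)%:E (krull_dim L) <= depth (@loc_max R q))%E.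
Proof.
split=> [h|h k kn ck]; last first.
  apply: depth_ge_at_of_depth; apply: le_trans h; rewrite le_min dim_of_chain // andbT.
  by rewrite lee_fin lez_nat.
have [nd|] := boolP ((n%:Z)%:E <= krull_dim L)%E.
  rewrite min_l //; apply: depth_of_depth_ge_at; apply: h => //; exact: chain_of_dim.
move=> nd.
have Dlt k : `[< chain k [set 0] q >] -> (k <= n)%N.
  move=> /asboolP ck; rewrite leqNgt; apply/negP => nk.
  by move/negP: nd; apply; apply: dim_of_chain; apply: chain_le ck; exact: ltnW.
have ex : exists k, `[< chain k [set 0] q >].
  exists 0%N; apply/asboolP; split=> // _ ->; exact: (id0 (prime_ideal pq)).
have [m /asboolP cm mmax] := ex_maxnP ex Dlt.
have dimL : krull_dim L = (m%:Z)%:E.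
  have le_m j : _ -> (j <= m)%N := fun Pj => mmax j (asboolT (chain_of_dim
    ((sup_nat_ge _ j).2 (ex_intro2 _ _ j Pj (leqnn j))))).
  have [j Pj mj] := (sup_nat_ge _ m).1 (dim_of_chain cm).
  apply: sup_nat_max => //.
  by have -> : m = j by apply/eqP; rewrite eqn_leq mj le_m.
have mn := Dlt _ (asboolT cm).
rewrite dimL min_r; first exact/depth_of_depth_ge_at/h.
by rewrite lee_fin lez_nat.
Qed.

End Localized.

(** * Descent of regular sequences *)

(** An ideal maximal among those over [I0] that do not contain [e] locally at [p]:
modulo it, the class of [e] spans the residue field of [p] after localization. *)
Lemma maximal_colon (R : comPzRingType) (p I0 : set R) (e : R) : noetherian R ->
  is_prime p -> is_ideal I0 -> ~ sat p I0 e ->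
  exists I, [/\ is_ideal I, I0 `<=` I & forall s, I (s * e) <-> p s].
Proof.
move=> nR pp idI0 ne.
have [|//|I [[idI nI] I0I Imax]] := noeth_max nR (I0 := I0)
  (F := [set I | is_ideal I /\ ~ sat p I e]); first by move=> ? [].
exists I; split=> // s; split=> [Ise|ps]; first by apply: contrapT => nps; apply: nI;
  exists s.
apply: contrapT => nIse.
have [u [pu [k [r [Ik uE]]]]] : sat p (adjoin I (s * e)) e.
  apply: contrapT => h; apply: nIse; apply: (Imax (adjoin I (s * e))).
  - by split=> //; exact: is_ideal_adjoin.
  - exact: sub_adjoin.
  - exact: adjoin_self.
apply: nI; exists (u - r * s); split.
  move=> h; apply: pu; rewrite -[u](subrK (r * s)).
  by apply: (idD (prime_ideal pp)) => //; exact: (idMl (prime_ideal pp)).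
by rewrite mulrBl uE mulrA addrK.
Qed.

(** If some [a] in [q] is not nilpotent modulo [ys] locally at [q], a prime below [q]
that contains [ys] avoids [a]; its height is at least the length of [ys], so that
of [q] is larger. By hypothesis the depth at [q] is then larger too, and [ys] is
not a maximal regular sequence. *)
Lemma regseq_at_socle_free_or_nilpotent (R : comPzRingType) (q : set R) (n : nat)
    (ys : seq R) :
  noetherian R -> is_prime q ->
  (forall k, (k <= n)%N -> chain k [set 0] q -> depth_ge_at q [set 0] k) ->
  (size ys < n)%N -> regseq_at q [set 0] ys ->
  socle_free q (adjoins [set 0] ys) \/
  forall a, q a -> exists m, sat q (adjoins [set 0] ys) (a ^+ m).
Proof.
move=> nR pq Sn szys rys.
have [h|/existsNP [a /not_implyP [qa /forallNP na]]] := pselect (forall a, q a ->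
  exists m, sat q (adjoins [set 0] ys) (a ^+ m)); first by right.
have id0 := is_ideal0 R; have idK := is_ideal_adjoins ys id0.
have [P [pP KP Pq nPa]] := prime_below nR pq idK na.
left; apply: depth_ge_at_socle_free => //; apply: (depth_ge_at_adjoins nR) => //.
rewrite addn1; apply: Sn => //; split=> //; exists P; first by split=> // /(_ _ qa).
exact: (regseq_at_chain nR (q := q)).
Qed.

Section Descent.
Variables (A B : comPzRingType) (f : {rmorphism A -> B}) (n : nat) (p : spec A).
Hypotheses (f_pure : pure f) (nB : noetherian B).
Hypothesis Sn : forall q : set B, is_prime q ->
  forall k, (k <= n)%N -> chain k [set 0] q -> depth_ge_at q [set 0] k.
Hypothesis fib : zero_dimensional (fiber_ring f p).

Let pp : is_prime p := specP p.
Let nA : noetherian A := pure_noetherian f_pure nB.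

Definition over (q : set B) := forall a, q (f a) <-> p a.

(** [x] avoids all associated primes of [B / K], except those that contain the image
of [p] and hence cannot be avoided. *)
Definition generic (K : set B) (x : A) := p x /\
  forall b, is_prime (colon K b) -> colon K b (f x) -> forall a, p a -> colon K b (f a).

Local Notation KA xs := (adjoins [set (0 : A)] xs).
Local Notation KB xs := (adjoins [set (0 : B)] (map f xs)).

Let idKA xs : is_ideal (KA xs). Proof. exact/is_ideal_adjoins/is_ideal0. Qed.
Let idKB xs : is_ideal (KB xs). Proof. exact/is_ideal_adjoins/is_ideal0. Qed.

Lemma adjoins_map xs a : KA xs a -> KB xs (f a).
Proof.
elim/last_ind: xs a => [|xs x IH] a /=; first by move=> ->; rewrite rmorph0.
rewrite map_rcons !adjoins_rcons => -[k [r [/IH kxs ->]]].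
by exists (f k), (f r); rewrite rmorphD rmorphM.
Qed.

Lemma generic_exists K : is_ideal K -> exists x, generic K x.
Proof.
move=> idK; have [L [pL LK]] := assoc_finite nB idK.
have [Q|x px xL] := @prime_avoidance A p
    [seq [set a | P (f a)] | P <- L & `[< ~ p `<=` [set a | P (f a)] >]] (prime_ideal pp).
  move=> /mapP [P]; rewrite mem_filter => /andP[/asboolP np PL] ->; split=> //.
  exact: (prime_preimage f (pL _ PL)).
exists x; split=> // b pb bx; apply: contrapT => np.
apply: (xL [set a | colon K b (f a)]) => //; apply/mapP; exists (colon K b) => //.
by rewrite mem_filter LK // andbT; apply/asboolP.
Qed.

Definition generic_seq xs :=
  forall pre x post, xs = pre ++ x :: post -> generic (KB pre) x.

Lemma generic_seq_rcons xs x : generic_seq (rcons xs x) ->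
  generic_seq xs /\ generic (KB xs) x.
Proof.
move=> g; split; last by apply: (g xs x [::]); rewrite cats1.
by move=> pre y post e; apply: (g pre y (rcons post x)); rewrite e rcons_cat.
Qed.

Lemma generic_seq_exists k : exists2 xs, size xs = k & generic_seq xs.
Proof.
elim: k => [|k [xs szxs g]]; first by exists [::] => // -[].
have [x gx] := generic_exists (idKB xs).
exists (rcons xs x); rewrite ?size_rcons ?szxs // => pre y post.
case/lastP: post => [|post z].
  by rewrite cats1 => /eqP; rewrite eqseq_rcons => /andP[/eqP <- /eqP <-].
rewrite -rcons_cons -rcons_cat => /eqP; rewrite eqseq_rcons => /andP[/eqP e _].
exact: g e.
Qed.

Lemma generic_seq_mem xs x : generic_seq xs -> x \in xs -> p x.
Proof. by move=> + xxs; case/splitPr: xxs => pre post /(_ pre x post erefl) []. Qed.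

(** An associated prime below [q] that contains [x] contains the image of [p] by
genericity, so it lies over [p] and is equal to [q]; but then [q] kills a nonzero
element. *)
Lemma generic_regular_at K q x : is_ideal K -> is_prime q -> over q -> generic K x ->
  socle_free q K -> regular_at q K (f x).
Proof.
move=> idK pq oq [px gx] sq; apply: regular_atP => // b pb bq bx.
apply: (socle_free_assoc pq idK sq pb bq).
apply: (fiber_incomparable fib pb pq _ oq bq) => a.
by split=> [/bq /oq //|]; exact: gx.
Qed.

(** Once the second alternative holds for an initial segment it persists, since the
ideal only grows. *)
Lemma generic_regseq_at q xs : is_prime q -> over q -> generic_seq xs ->
  (size xs <= n)%N ->
  regseq_at q [set 0] (map f xs) \/ forall a, p a -> exists m, sat q (KB xs) (f a ^+ m).
Proof.
move=> pq oq; elim/last_ind: xs => [|xs x IH]; first by left.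
move=> /generic_seq_rcons [gxs gx]; rewrite size_rcons => szxs.
have [rxs|nil] := IH gxs (ltnW szxs); last first.
  right=> a /nil [m sm]; exists m; apply: sat_mono sm.
  by rewrite map_rcons adjoins_rcons; exact: sub_adjoin.
have [|sq|nil] := regseq_at_socle_free_or_nilpotent nB pq (Sn pq) _ rxs;
  first by rewrite size_map.
  left; rewrite map_rcons; apply: regseq_at_rcons => //; last exact: generic_regular_at.
  by apply/oq; case: gx.
right=> a /oq /nil [m sm]; exists m; apply: sat_mono sm.
by rewrite map_rcons adjoins_rcons; exact: sub_adjoin.
Qed.

Lemma generic_dichotomy q xs : is_prime q -> over q -> generic_seq xs ->
  (size xs < n)%N ->
  socle_free q (KB xs) \/ forall a, p a -> exists m, sat q (KB xs) (f a ^+ m).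
Proof.
move=> pq oq gxs szxs.
have [rxs|] := generic_regseq_at pq oq gxs (ltnW szxs); last by right.
have [|sq|nil] := regseq_at_socle_free_or_nilpotent nB pq (Sn pq) _ rxs.
- by rewrite size_map.
- by left.
- by right=> a /oq /nil.
Qed.

Lemma prime_over (H : set B) : is_ideal H -> over H ->
  exists q, [/\ is_prime q, H `<=` q & over q].
Proof.
move=> idH oH.
have [||q [pq Hq qT]] := @prime_disjoint _ nB [set f s | s in ~` (p : set A)] H _ idH.
- split; first by exists 1; [exact: prime1|exact: rmorph1].
  move=> _ _ [s ps <-] [t pt <-]; exists (s * t); last exact: rmorphM.
  exact: (primeM pp).
- by move=> _ [s ps <-] /oH.
exists q; split=> // a; split=> [qa|pa]; last by apply: Hq; apply/oH.
by apply: contrapT => pa; apply: (qT (f a)) => //; exists a.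
Qed.

(** Let [I1] and [I2] contain [J = (xs)] and be such that the annihilators of [c] in
[A / I1] and of [w] in [A / I2] are both [p]. In the amalgam
[(A / I1 (+) A / I2) / A (c, - w)] the common image [v] of [c] and [w] still has
annihilator [p]. By purity the annihilator [H] of [1 (x) v] lies over [p], and so
does some prime [q] over [H]. If [c] or [w] vanished at [q] modulo the extension
of [J], then [1 (x) v] would vanish at [q]. *)
Lemma amalgam (xs : seq A) (c w : A) : ~ sat p (KA xs) c -> ~ sat p (KA xs) w ->
  exists q, [/\ is_prime q, over q, ~ sat q (KB xs) (f c) & ~ sat q (KB xs) (f w)].
Proof.
move=> nc nw.
have [I1 [idI1 JI1 I1c]] := maximal_colon nA pp (idKA xs) nc.
have [I2 [idI2 JI2 I2w]] := maximal_colon nA pp (idKA xs) nw.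
pose V : lmodType A := (A^o * A^o)%type.
pose U : set V := [set v | exists i j r, [/\ I1 i, I2 j & v = (i + r * c, j - r * w)]].
have subU : is_submod U.
  split.
  - exists 0, 0, 0; split; [exact: id0|exact: id0|].
    by rewrite !mul0r addr0 subr0.
  - move=> _ _ [i [j [r [I1i I2j ->]]]] [i' [j' [r' [I1i' I2j' ->]]]].
    exists (i + i'), (j + j'), (r + r'); split; [exact: idD|exact: idD|].
    have -> : i + i' + (r + r') * c = (i + r * c) + (i' + r' * c) by ring.
    by have -> : j + j' - (r + r') * w = (j - r * w) + (j' - r' * w) by ring.
  - move=> a _ [i [j [r [I1i I2j ->]]]].
    exists (a * i), (a * j), (a * r); split; [exact: idMl|exact: idMl|].
    have -> : a * i + a * r * c = a * (i + r * c) by ring.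
    by have -> : a * j - a * r * w = a * (j - r * w) by ring.
have [H [idH HE Hidl]] := pure_annihilator f_pure (Submod subU) ((c, 0) : V).
have oH : over H.
  move=> s; rewrite HE /=; split=> [[i [j [r [I1i I2j e]]]]|ps].
    have e1 : s * c = i + r * c := congr1 fst e.
    have e2 : s * 0 = j - r * w := congr1 snd e.
    have pr : p r.
      apply/I2w; have -> : r * w = j - s * 0 by rewrite e2; ring.
      by rewrite mulr0 subr0.
    by apply/I1c; rewrite e1; apply: idD => //; apply/I1c.
  exists (s * c), 0, 0; split; [exact/I1c|exact: id0|].
  by rewrite !mul0r addr0 subr0 -[LHS]/(s * c, s * 0) mulr0.
have [q [pq Hq oq]] := prime_over idH oH.
exists q; split=> //.
- move=> [u [qu Ku]]; apply: qu; apply: Hq; apply: (Hidl c ((1, 0) : V) xs) Ku.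
    exists 0, 0, 0; split; [exact: id0|exact: id0|].
    by rewrite -[LHS]/(c - c * 1, 0 - c * 0) mulr1 mulr0 !mul0r !subrr addr0.
  move=> x xxs; exists x, 0, 0; split; [|exact: id0|].
    by apply: JI1; apply: adjoins_mem => //; exact: is_ideal0.
  by rewrite -[LHS]/(x * 1, x * 0) mulr1 mulr0 !mul0r addr0 subr0.
- move=> [u [qu Ku]]; apply: qu; apply: Hq; apply: (Hidl w ((0, 1) : V) xs) Ku.
    exists 0, 0, 1; split; [exact: id0|exact: id0|].
    by rewrite -[LHS]/(c - w * 0, 0 - w * 1) mulr1 mulr0 !mul1r subr0 !add0r.
  move=> x xxs; exists 0, x, 0; split; [exact: id0| |].
    by apply: JI2; apply: adjoins_mem => //; exact: is_ideal0.
  by rewrite -[LHS]/(x * 0, x * 1) mulr1 mulr0 !mul0r addr0 subr0.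
Qed.

Lemma generic_regular_at_descent xs x (Q : set A) : generic_seq xs -> generic (KB xs) x ->
  (size xs < n)%N -> is_prime Q -> KA xs `<=` Q -> Q `<` p -> regular_at p (KA xs) x.
Proof.
move=> gxs gx szxs pQ KQ [Qp npQ] c Kxc; apply: contrapT => nc.
have [a [pa nQa]] : exists a, p a /\ ~ Q a.
  apply: contrapT => h; apply: npQ => a pa; apply: contrapT => nQa; apply: h; by exists a.
(* The annihilators of the powers of [a] modulo the extended ideal stabilize, which
   makes the exponent uniform in [q]. *)
have [N hN] : exists N, forall m, colon (KB xs) (f a ^+ m) `<=` colon (KB xs) (f a ^+ N).
  apply: (noeth_chain nB) => m; first exact: is_ideal_colon.
  by move=> b; rewrite /colon /= exprS mulrCA; exact: idMl.
have nw : ~ sat p (KA xs) (a ^+ N).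
  move=> [u [pu /KQ Qua]]; apply: primeM Qua => //; first by move=> /Qp.
  exact: primeX.
have [q [pq oq nfc nfw]] := amalgam nc nw.
have [sq|nil] := generic_dichotomy pq oq gxs szxs.
  apply: nfc; apply: (generic_regular_at (x := x)) => //.
  by rewrite -rmorphM; exact: adjoins_map.
have [m [u [qu Ku]]] := nil a pa.
apply: nfw; exists u; split=> //; rewrite rmorphXn; exact: (hN m).
Qed.

Lemma generic_regseq_at_descent xs : generic_seq xs -> (size xs <= n)%N ->
  chain (size xs) [set 0] p -> regseq_at p [set 0] xs.
Proof.
elim/last_ind: xs => [//|xs x IH] /generic_seq_rcons [gxs gx].
rewrite size_rcons => szxs cp; apply: regseq_at_rcons.
- by apply: IH => //; [exact: ltnW|exact: chain_le cp].
- by case: gx.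
have [] : chain 1 (KA xs) p.
  apply: (chain_adjoins nA) => //; [exact: is_ideal0|by move=> y;
    exact: generic_seq_mem|].
  by rewrite addn1.
by move=> _ [Q Qp [pQ KQ]]; exact: generic_regular_at_descent Qp.
Qed.

End Descent.

Theorem theorem2p8 (n : nat) (n_ge1 : (1 <= n)%N) (A B : comPzRingType)
  (f : {rmorphism A -> B}) (f_pure : pure f)
  (B_noetherian : noetherian B) (B_serre : serre n B)
  (f_fibers : forall p : spec A, zero_dimensional (fiber_ring f p)) :
  serre n A.
Proof.
split; first exact: pure_noetherian f_pure B_noetherian.
move=> p; apply/serre_local => k kn ck.
have Sn (q : set B) : is_prime q ->
    forall k, (k <= n)%N -> chain k [set 0] q -> depth_ge_at q [set 0] k.
  by move=> pq; case: B_serre => _ /(_ (Spec pq)) /serre_local.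
have [xs szxs gxs] := generic_seq_exists f p B_noetherian k.
exists xs => //;
  apply: (generic_regseq_at_descent f_pure B_noetherian Sn (f_fibers p)) => //.
  by rewrite szxs.
by rewrite szxs.
Qed.
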